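(* Let $(X,Y)$ be an O2BP with parameters $\alpha,\beta,\gamma,\delta$ and correlation $\rho$, and let $\tau^{\mathbf 0}:=\inf\{t>0:(X_t,Y_t)=(0,0)\}$ (with $\inf\emptyset=\infty$). Then $\mathbb P(\tau^{\mathbf 0}<\infty)=0$ if one of the following conditions holds: $C_1$: $\beta\geq 0$, $\gamma\geq 0$ and $-1\leq\rho\leq\alpha+\delta$; $C_{2a}$: $\alpha\geq\frac12$ and $\beta\geq 0$; $C_{2b}$: $\delta\geq\frac12$ and $\gamma\geq 0$; $C_3$: there exist $\lambda>0$ and $\mu>0$ such that $\lambda\alpha+\mu\gamma\geq 0$, $\lambda\beta+\mu\delta\geq 0$ and \[\Big(\sqrt{\lambda(\lambda\alpha+\mu\gamma)}+\sqrt{\mu(\lambda\beta+\mu\delta)}\Big)^2\geq\tfrac12(\lambda^2+\mu^2+2\rho\lambda\mu).\]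
   Context: Let $(\Omega,\mathcal F,(\mathcal F_t)_{t\geq0},\mathbb P)$ be a complete filtered probability space satisfying the usual conditions, and $(B,C)$ an $(\mathcal F_t)$-adapted planar Brownian motion started at $0$ with $\langle B\rangle_t=\langle C\rangle_t=t$ and $\langle B,C\rangle_t=\rho t$, where $\rho\in[-1,1]$. Let $\alpha>0$, $\delta>0$, $\beta,\gamma\in\mathbb R$, $S=[0,\infty)^2$. An Oblique Two-dimensional Bessel Process (O2BP), also called a solution to the system (O), is an $(\mathcal F_t)$-adapted continuous process $(X,Y)$ with values in $S$ such that for all $t\geq0$ \[X_t=X_0+B_t+\alpha\int_0^t\frac{ds}{X_s}+\beta\int_0^t\frac{ds}{Y_s},\qquad Y_t=Y_0+C_t+\gamma\int_0^t\frac{ds}{X_s}+\delta\int_0^t\frac{ds}{Y_s},\] where $X_0,Y_0$ are nonnegative $\mathcal F_0$-measurable random variables, and for all $t\geq 0$: $\int_0^t\mathbf 1_{\{X_s=0\}}ds=\int_0^t\mathbf 1_{\{Y_s=0\}}ds=0$, $\int_0^t\mathbf 1_{\{X_s>0\}}\frac{ds}{X_s}<\infty$, $\int_0^t\mathbf 1_{\{Y_s>0\}}\frac{ds}{Y_s}<\infty$. *)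

(* Defs.v *)
From HB Require Import structures.
From mathcomp Require Import all_boot all_order all_algebra.
From mathcomp Require Import all_classical all_reals all_analysis.
Set Implicit Arguments. Unset Strict Implicit. Unset Printing Implicit Defensive.
Import Order.TTheory GRing.Theory Num.Theory.
Import numFieldNormedType.Exports.
Local Open Scope classical_set_scope.
Local Open Scope ring_scope.

Section O2BP.
Context {d : measure_display} {Omega : measurableType d} {R : realType}.
Variable P : probability Omega R.

Definition complete_prob_space :=
  forall N : set Omega, measurable N -> P N = 0%E ->
    forall A, A `<=` N -> measurable A.

Definition filtration (F : R -> set (set Omega)) :=
  (forall t, 0 <= t -> sigma_algebra setT (F t) /\ F t `<=` measurable) /\
  (forall s t, 0 <= s -> s <= t -> F s `<=` F t).

Definition usual_conditions (F : R -> set (set Omega)) :=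
  (forall N, measurable N -> P N = 0%E -> F 0 N) /\
  (forall t, 0 <= t -> forall A, F t A <-> (forall s, t < s -> F s A)).

Definition adapted (F : R -> set (set Omega)) (Z : R -> Omega -> R) :=
  forall t, 0 <= t -> forall E : set R, measurable E -> F t (Z t @^-1` E).

(* (B,C) is an (F_t)-planar Brownian motion started at 0 with
   <B>_t = <C>_t = t and <B,C>_t = rho t: continuous adapted paths and,
   for s <= t, the increment (B_t - B_s, C_t - C_s) is independent of F_s
   and centred Gaussian with covariance (t-s)[[1,rho],[rho,1]]; this is
   encoded through the joint moment generating function restricted to
   events of F_s. *)
Definition correlated_BM (F : R -> set (set Omega)) (rho : R)
    (B C : R -> Omega -> R) :=
  [/\ adapted F B, adapted F C,
   {ae P, forall w, B 0 w = 0 /\ C 0 w = 0 /\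
      {within [set s : R | 0 <= s], continuous (fun s => B s w)} /\
      {within [set s : R | 0 <= s], continuous (fun s => C s w)}} &
   forall s t, 0 <= s -> s <= t -> forall A, F s A -> forall u1 u2 : R,
     (\int[P]_(w in A)
         (expR (u1 * (B t w - B s w) + u2 * (C t w - C s w)))%:E
      = P A * (expR ((t - s) / 2 * (u1 ^+ 2 + 2 * rho * u1 * u2 + u2 ^+ 2)))%:E)%E].

(* int_0^t ds / Z_s (path-wise Lebesgue integral; in MathComp 0^-1 = 0, so
   this is the integral of 1_{Z_s > 0} / Z_s) *)
Definition inv_int (Z : R -> Omega -> R) (w : Omega) (t : R) : \bar R :=
  \int[lebesgue_measure]_(s in `[0, t]%classic) ((Z s w)^-1)%:E.

Definition O2BP (F : R -> set (set Omega)) (alpha beta gamma delta rho : R)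
    (B C X Y : R -> Omega -> R) :=
  [/\ correlated_BM F rho B C, adapted F X, adapted F Y &
   {ae P, forall w,
     [/\ forall t, 0 <= t -> 0 <= X t w /\ 0 <= Y t w,
      {within [set s : R | 0 <= s], continuous (fun s => X s w)},
      {within [set s : R | 0 <= s], continuous (fun s => Y s w)} &
      forall t, 0 <= t ->
        [/\ lebesgue_measure (`[0, t] `&` [set s | X s w = 0]) = 0%E,
            lebesgue_measure (`[0, t] `&` [set s | Y s w = 0]) = 0%E,
            (inv_int X w t < +oo)%E /\ (inv_int Y w t < +oo)%E,
            X t w = X 0 w + B t w + alpha * fine (inv_int X w t)
                                  + beta * fine (inv_int Y w t) &
            Y t w = Y 0 w + C t w + gamma * fine (inv_int X w t)
                                  + delta * fine (inv_int Y w t)]]}].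

End O2BP.

(* Main.v *)
Require Import Defs.
From HB Require Import structures.
From mathcomp Require Import all_boot all_order all_algebra.
From mathcomp Require Import all_classical all_reals all_analysis.
From mathcomp Require Import measurable_realfun.
From mathcomp Require Import ring lra.
Set Implicit Arguments. Unset Strict Implicit. Unset Printing Implicit Defensive.
Import Order.TTheory GRing.Theory Num.Theory.
Import numFieldNormedType.Exports.
Local Open Scope classical_set_scope.
Local Open Scope ring_scope.

(** Let [Phi] be [lambda X + mu Y] (conditions C2 and C3, where C2 is C3 with
    one zero weight) or [X^2 + Y^2] (condition C1).  By Ito's formula,
    [- ln Phi] would be a local supermartingale, so that [Phi] cannot reach [0]
    from a positive value; a positive value is available at some rational time
    before any [t > 0] because the zero sets of [X] and [Y] are Lebesgue-null.

    Ito's formula is replaced by a discrete-time estimate.  On a grid of mesh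
    [h], the process [S = L - ln (Phi + ka)] satisfies
    [S' <= S - D + D^2 / 2 + o(h)] on the event where the paths oscillate by at
    most [r] during the step, where [D] is an explicit polynomial in the Brownian
    increments; its conditional expectation follows from the conditional
    moments, which are read off the moment generating function.  Summing over
    the grid bounds the probability that [Phi <= ka] at a grid point by
    [K / ln (1 / ka)] with [K] independent of [ka]; then [h], [r] and finally
    [ka] tend to [0].

    For [Phi = X^2 + Y^2] the one-step estimate loses a term of order [h] while
    [X] or [Y] is below a level [k2].  The time spent there is at most
    [2 k2 (int ds/X + int ds/Y)], so the process may be killed as soon as this
    time exceeds a small budget [eps]. *)

(** Only moments conditional on the past are available, whereas a good step is decided by the
    increments themselves. So [- ln (1 + x)] is replaced on good steps by a polynomial majorant, and
    a quartic term of mean [O(h ^+ 2)] keeps it nonnegative on the other steps; the indicator of the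
    good step can then be dropped. Adding [ka] bounds the logarithm from below.

    The order of choice keeps the final constant free of [ka]: first [ka], then the drift excess [C]
    and the budget [eps = 1 / (C + 1)], then [k2], the coefficient bound [K], the tolerance
    [th = 1 / (5 T)], the radius [r] and the mesh. The compensated excess is then at most [1], and
    the step errors [5 * th * h] sum to [1].

    Each condition makes the Ito drift of [- ln Phi] nonpositive: for linear [Phi] by Cauchy-Schwarz
    on the singular drift, for quadratic [Phi] by [2 rho x y <= (alpha + delta) (x ^+ 2 + y ^+ 2)].

    Reaching the origin at some real time is not known to be a measurable event, so it is covered by
    measurable sets of small probability. *)

Section ElementaryBounds.
Context {R : realType}.
Implicit Types (x y z : R) (f : R -> R).

(** Common tool for the exponential and logarithmic bounds below. Multiplying a Taylor polynomial by
    the opposite exponential makes all but the top-degree term of the derivative cancel, so the sign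
    of the derivative is visible. *)
Lemma derive_ge0_ge0 f (f' : R -> R) x :
  (forall z, 0 <= z -> is_derive z 1 f (f' z)) ->
  (forall z, 0 <= z -> 0 <= f' z) -> f 0 = 0 -> 0 <= x -> 0 <= f x.
Proof.
move=> df f'0 f0 x0.
have [->|xn0] := eqVneq x 0; first by rewrite f0.
have {xn0}x0' : 0 < x by rewrite lt_neqAle eq_sym xn0.
have [c /andP[c0 _]] : exists2 c, c \in `]0, x[ & f x - f 0 = f' c * (x - 0).
  apply: (@MVT R f f' 0 x x0') => [c|].
    by rewrite in_itv/= => /andP[/ltW + _]; exact: df.
  apply: derivable_within_continuous => c; rewrite in_itv/= => /andP[c0 _].
  by case: (df c c0).
by rewrite f0 !subr0 => ->; rewrite mulr_ge0// f'0// ltW.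
Qed.

Lemma expR_ge_taylor4 x : 0 <= x ->
  1 + x + x ^+ 2 / 2 + x ^+ 3 / 6 + x ^+ 4 / 24 <= expR x.
Proof.
move=> x0.
set p := fun z : R => 1 + z + z ^+ 2 / 2 + z ^+ 3 / 6 + z ^+ 4 / 24.
have : 0 <= 1 - expR (- x) * p x.
  apply: (@derive_ge0_ge0 (fun z => 1 - expR (- z) * p z)
    (fun z => expR (- z) * (z ^+ 4 / 24))) => //.
  - move=> z _; rewrite /p; apply: is_derive_eq.
    by rewrite /GRing.scale/=; field.
  - by move=> z z0; rewrite mulr_ge0 ?expR_ge0// divr_ge0// exprn_ge0.
  - by rewrite oppr0 expR0 /p !expr0n/=; field.
by rewrite subr_ge0 expRN mulrC ler_pdivrMr ?expR_gt0// mul1r.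
Qed.

Lemma expRN_ge_taylor3 x : 0 <= x ->
  1 - x + x ^+ 2 / 2 - x ^+ 3 / 6 <= expR (- x).
Proof.
move=> x0.
set p := fun z : R => 1 - z + z ^+ 2 / 2 - z ^+ 3 / 6.
have : 0 <= 1 - expR x * p x.
  apply: (@derive_ge0_ge0 (fun z => 1 - expR z * p z)
    (fun z => expR z * (z ^+ 3 / 6))) => //.
  - move=> z _; rewrite /p; apply: is_derive_eq.
    by rewrite /GRing.scale/=; field.
  - by move=> z z0; rewrite mulr_ge0 ?expR_ge0// divr_ge0// exprn_ge0.
  - by rewrite expR0 /p !expr0n/=; field.
by rewrite subr_ge0 expRN -[X in _ -> _ <= X]mul1r ler_pdivlMr ?expR_gt0// mulrC.
Qed.

Lemma expRN_le_taylor2 x : 0 <= x -> expR (- x) <= 1 - x + x ^+ 2 / 2.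
Proof.
move=> x0.
set p := fun z : R => 1 - z + z ^+ 2 / 2.
have : 0 <= expR x * p x - 1.
  apply: (@derive_ge0_ge0 (fun z => expR z * p z - 1)
    (fun z => expR z * (z ^+ 2 / 2))) => //.
  - move=> z _; rewrite /p; apply: is_derive_eq.
    by rewrite /GRing.scale/=; field.
  - by move=> z z0; rewrite mulr_ge0 ?expR_ge0// divr_ge0// exprn_ge0.
  - by rewrite expR0 /p !expr0n/=; field.
by rewrite subr_ge0 expRN -[X in _ -> X <= _]mul1r ler_pdivrMr ?expR_gt0// mulrC.
Qed.

Lemma expR_le_taylor2 x : 0 <= x ->
  expR x <= 1 + x + x ^+ 2 / 2 + x ^+ 3 * expR x.
Proof.
move=> x0.
set p := fun z : R => 1 + z + z ^+ 2 / 2.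
have : 0 <= expR (- x) * p x + x ^+ 3 - 1.
  apply: (@derive_ge0_ge0 (fun z => expR (- z) * p z + z ^+ 3 - 1)
    (fun z => z ^+ 2 * (3 - expR (- z) / 2))) => //.
  - move=> z _; rewrite /p; apply: is_derive_eq.
    by rewrite /GRing.scale/=; field.
  - move=> z z0; rewrite mulr_ge0 ?exprn_ge0//.
    by have : expR (- z) <= 1 by [rewrite expR_le1 oppr_le0]; lra.
  - by rewrite oppr0 expR0 /p !expr0n/=; field.
rewrite expRN => h; have e0 := expR_gt0 x.
suff : 0 <= (p x + x ^+ 3 * expR x - expR x) by rewrite /p; lra.
have -> : p x + x ^+ 3 * expR x - expR x
  = expR x * ((expR x)^-1 * p x + x ^+ 3 - 1) by field; rewrite gt_eqF.
by rewrite mulr_ge0// ltW.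
Qed.

Lemma expR_taylor2_norm x :
  `|expR x - 1 - x - x ^+ 2 / 2| <= `|x| ^+ 3 * expR `|x|.
Proof.
have [x0|x0] := leP 0 x.
  rewrite !ger0_norm//.
    by have := expR_le_taylor2 x0; lra.
  have := expR_ge_taylor4 x0; have := exprn_ge0 3 x0; have := exprn_ge0 4 x0; lra.
have y0 : 0 <= - x by lra.
have := expRN_le_taylor2 y0; have := expRN_ge_taylor3 y0.
rewrite (ltr0_norm x0) opprK => h1 h2.
have y3 := exprn_ge0 3 y0.
have h3 : (- x) ^+ 3 <= (- x) ^+ 3 * expR (- x).
  by rewrite ler_peMr// -expR0 ler_expR.
rewrite sqrrN in h1 h2.
by rewrite ler_norml; apply/andP; split; lra.
Qed.

(** In the sum of the lower Taylor bounds at [x] and [- x] the odd terms cancel. This converts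
    values of the moment generating function into bounds on second and fourth moments. *)
Lemma quartic_le_cosh x : x ^+ 4 / 24 <= expR x + expR (- x) - 2 - x ^+ 2.
Proof.
wlog x0 : x / 0 <= x => [h|].
  have [/h//|x0] := leP 0 x.
  have := h (- x); rewrite opprK sqrrN (_ : (- x) ^+ 4 = x ^+ 4); last by ring.
  by lra.
by have := expR_ge_taylor4 x0; have := expRN_ge_taylor3 x0; lra.
Qed.

Lemma expR_norm_le x : expR `|x| <= expR x + expR (- x).
Proof.
by case: (ger0P x) => _; have := expR_ge0 x; have := expR_ge0 (- x); lra.
Qed.

Lemma cube_le_expR x : 0 <= x -> x ^+ 3 <= 6 * expR x.
Proof.
move=> x0; have := expR_ge_taylor4 x0.
by have := exprn_ge0 4 x0; have := exprn_ge0 2 x0; lra.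
Qed.

Lemma expR_le_quadratic x : 0 <= x <= 1 / 2 -> expR x <= 1 + x + 2 * x ^+ 2.
Proof.
move=> /andP[x0 x1].
have := expR_ge1Dx (- x); rewrite expRN => h.
have h2 : expR x <= (1 - x)^-1.
  by rewrite -[leLHS]invrK lef_pV2 ?posrE ?invr_gt0 ?expR_gt0//; lra.
apply: (le_trans h2); rewrite -[leLHS]mul1r ler_pdivrMr; last lra.
by have := mulr_ge0 (sqr_ge0 x) (_ : 0 <= 1 - 2 * x); lra.
Qed.

Lemma opp_ln_taylor x : `|x| <= 1 / 4 ->
  - ln (1 + x) <= - x + x ^+ 2 / 2 + `|x| ^+ 3.
Proof.
move=> x12.
have [x0|x0] := leP 0 x.
  have : 0 <= (1 + x) * expR (- x + x ^+ 2 / 2) - 1.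
    (* The derivative of the exponent is [z - 1], and [1 + (1 + z) * (z - 1) = z ^+ 2]. *)
    apply: (@derive_ge0_ge0 (fun z => (1 + z) * expR (- z + z ^+ 2 / 2) - 1)
      (fun z => z ^+ 2 * expR (- z + z ^+ 2 / 2))) => //.
    - by move=> z z0; apply: is_derive_eq; rewrite /GRing.scale/=; field.
    - by move=> z z0; rewrite mulr_ge0 ?exprn_ge0 ?expR_ge0.
    - by rewrite oppr0 !expr0n/= mul0r !addr0 expR0 mulr1 subrr.
  rewrite subr_ge0 => h; have x1 : 0 < 1 + x by lra.
  have : ln 1 <= ln ((1 + x) * expR (- x + x ^+ 2 / 2)).
    by rewrite ler_ln ?posrE// mulr_gt0// expR_gt0.
  rewrite ln1 lnM ?posrE ?expR_gt0// expRK.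
  by have := exprn_ge0 3 (normr_ge0 x); lra.
rewrite (ltr0_norm x0) in x12 *.
have [y xE] : exists y, x = - y by exists (- x); rewrite opprK.
rewrite {}xE !opprK sqrrN in x0 x12 *.
have y0 : 0 <= y by lra.
have y3 := exprn_ge0 3 y0.
suff : expR (- (y + y ^+ 2 / 2 + y ^+ 3)) <= 1 - y.
  move=> h; have y1 : 0 < 1 - y by lra.
  by rewrite lerNl -[leLHS]expRK ler_ln ?posrE ?expR_gt0.
have z0 : 0 <= y + y ^+ 2 / 2 + y ^+ 3 by have := sqr_ge0 y; lra.
apply: (le_trans (expRN_le_taylor2 z0)).
rewrite -subr_ge0.
(* The cubic slack leaves a factor [y ^+ 3]; the cofactor is positive because [y <= 1 / 4]. *)
have -> : 1 - y - (1 - (y + y ^+ 2 / 2 + y ^+ 3) + (y + y ^+ 2 / 2 + y ^+ 3) ^+ 2 / 2)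
  = y ^+ 3 * (1/2 - (9 / 8) * y - y ^+ 2 / 2 - y ^+ 3 / 2) by field.
rewrite mulr_ge0//.
have y2 : y ^+ 2 <= y by rewrite expr2 ler_piMr//; lra.
have : y ^+ 3 <= y ^+ 2 by rewrite exprS ler_piMl ?sqr_ge0//; lra.
have y2' : y ^+ 2 <= y / 4 by rewrite expr2 [leRHS](_ : _ = y * (1 / 4)) ?ler_wpM2l//; lra.
lra.
Qed.

End ElementaryBounds.

(** Replaces a passage to the limit [e -> 0] when an identity is known up to an error linear in
    [e]. *)
Lemma eq0_small (R : realFieldType) (x C e0 : R) : 0 < e0 ->
  (forall e, 0 < e <= e0 -> `|x| <= e * C) -> x = 0.
Proof.
move=> e00 h; apply/eqP; rewrite -normr_le0 leNgt; apply/negP => x0.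
have C0 : 0 < C.
  by have := h e0; rewrite e00 lexx -(pmulr_rgt0 C e00) => /(_ isT); exact: lt_le_trans.
pose e := Num.min e0 (`|x| / (2 * C)).
have e_gt0 : 0 < e by rewrite lt_min e00 divr_gt0// mulr_gt0.
have := h e; rewrite e_gt0 ge_min lexx/= => /(_ isT).
move=> he; have h1 : e * C <= `|x| / (2 * C) * C.
  by rewrite ler_pM2r// ge_min lexx orbT.
have h2 : `|x| / (2 * C) * C = `|x| / 2 by field; rewrite gt_eqF.
lra.
Qed.

(** * Expectations of real random variables *)

Section Expectation.
Context {d : measure_display} {T : measurableType d} {R : realType}.
Variable P : probability T R.
Implicit Types (f g : T -> R) (A : set T) (K : R).

Definition intg f := P.-integrable setT (EFin \o f).

Lemma intg_bounded f K :
  measurable_fun setT f -> (forall w, `|f w| <= K) -> intg f.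
Proof.
move=> mf fK; apply: measurable_bounded_integrable => //.
  by rewrite -ge0_fin_numE// fin_num_measure.
exists K; split; first exact: num_real.
by move=> x Kx w _ /=; exact: le_trans (fK w) (ltW Kx).
Qed.

Lemma intg_cst K : intg (fun=> K).
Proof. exact: (@intg_bounded _ `|K|). Qed.

Lemma intgM_bounded f g K : measurable_fun setT f ->
  (forall w, `|f w| <= K) -> intg g -> intg (fun w => f w * g w).
Proof.
move=> mf fK ig.
have := @integrableMr _ _ _ P setT measurableT f (EFin \o g) mf _ ig.
apply; exists K; split; first exact: num_real.
by move=> x Kx w _ /=; exact: le_trans (fK w) (ltW Kx).
Qed.

Lemma intg_dom f g : measurable_fun setT f ->
  (forall w, `|f w| <= g w) -> intg g -> intg f.
Proof.
move=> mf fg ig; apply: le_integrable ig => //; first exact/measurable_EFinP.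
by move=> w _ /=; rewrite lee_fin (le_trans (fg w))// ler_norm.
Qed.

Lemma intgD f g : intg f -> intg g -> intg (fun w => f w + g w).
Proof. by move=> fi gi; exact: (integrableD measurableT fi gi). Qed.

Lemma intgB f g : intg f -> intg g -> intg (fun w => f w - g w).
Proof. by move=> fi gi; exact: (integrableB measurableT fi gi). Qed.

Lemma intgZ K f : intg f -> intg (fun w => K * f w).
Proof. by move=> fi; exact: (integrableZl measurableT K fi). Qed.

Lemma indic_bound A w : `|\1_A w : R| <= 1.
Proof. by rewrite indicE; case: (_ \in _); rewrite ?normr1 ?normr0. Qed.

Lemma intg_indic A f : measurable A -> intg f -> intg (fun w => \1_A w * f w).
Proof.
move=> mA; apply: (@intgM_bounded _ _ 1); last exact: indic_bound.
exact: measurable_indic.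
Qed.

Lemma Rint_indic A f : \int[P]_w (\1_A w * f w) = \int[P]_(w in A) f w.
Proof.
rewrite [RHS]Rintegral_mkcond; apply: eq_Rintegral => w _.
by rewrite patchE indicE; case: (w \in A); rewrite (mul1r, mul0r).
Qed.

Lemma Rint_P A : measurable A -> \int[P]_w \1_A w = fine (P A).
Proof.
move=> mA; transitivity (\int[P]_w (\1_A w * 1)).
  by apply: eq_Rintegral => w _; rewrite mulr1.
by rewrite Rint_indic Rintegral_cst// mul1r.
Qed.

Lemma Rint_cst K : \int[P]_w K = K.
Proof.
rewrite Rintegral_cst// -[RHS]mulr1; congr (_ * _).
have PT : P setT = 1%E by exact: probability_setT.
by rewrite -[RHS]/(fine 1%E) -PT.
Qed.

Lemma le_Rint f g : intg f -> intg g -> (forall w, f w <= g w) ->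
  \int[P]_w f w <= \int[P]_w g w.
Proof. by move=> fi gi fg; apply: le_Rintegral. Qed.

Lemma Rint_sum (n : nat) (f : nat -> T -> R) : (forall i, intg (f i)) ->
  intg (fun w => \sum_(i < n) f i w) /\
  \int[P]_w (\sum_(i < n) f i w) = \sum_(i < n) \int[P]_w f i w.
Proof.
move=> fi; elim: n => [|n [IHi IH]].
  under [X in intg X]funext do rewrite big_ord0.
  under eq_Rintegral do rewrite big_ord0.
  by rewrite big_ord0 Rint_cst; split => //; exact: intg_cst.
under [X in intg X]funext do rewrite big_ord_recr.
under eq_Rintegral do rewrite big_ord_recr.
split; first exact: intgD.
by rewrite (RintegralD measurableT IHi (fi n)) big_ord_recr/= -IH.
Qed.

End Expectation.

(* The sum counts the integers of [1, n] below [x]. *)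
Lemma sum_steps_bounds (R : realType) (n : nat) (x : R) : 0 <= x <= n%:R ->
  x - 1 <= \sum_(k < n) ((k.+1%:R : R) <= x)%R%:R <= x.
Proof.
elim: n => [|n IH] /andP[x0 xn].
  by rewrite big_ord0; apply/andP; split; lra.
rewrite big_ord_recr/=; have [nx|xn'] := leP n%:R x; last first.
  have -> : (n.+1%:R <= x) = false.
    by apply/negbTE; rewrite -ltNge (lt_le_trans xn')// ler_nat.
  by rewrite addr0; apply: IH; rewrite x0 ltW.
have -> : \sum_(k < n) ((k.+1%:R : R) <= x)%R%:R = n%:R :> R.
  under eq_bigr => k _.
    rewrite (_ : _ <= x = true); last by rewrite (le_trans _ nx)// ler_nat.
    over.
  by rewrite sumr_const card_ord.
have e : n.+1%:R = n%:R + 1 :> R by rewrite natr1.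
by have [h|h] := leP n.+1%:R x => /=; rewrite e in h xn; apply/andP; split; lra.
Qed.

(** * Conditional expectation by freezing variables of the past *)

Section Freezing.
Context {d : measure_display} {T : measurableType d} {R : realType}.
Variable P : probability T R.
Variable G : set (set T).
Hypothesis sG : sigma_algebra setT G.
Hypothesis Gm : G `<=` measurable.
Implicit Types (xi g : T -> R).

(** Measurability is stated on the type carrying the sigma-algebra generated by [G], so that the
    usual closure properties of measurable functions apply verbatim; as [G] is already a
    sigma-algebra, nothing is added ([gmeasP]). *)
Definition gmeas (xi : T -> R) :=
  measurable_fun (setT : set (g_sigma_algebraType G)) (xi : g_sigma_algebraType G -> R).

Lemma gmeasP xi : gmeas xi <-> forall E, measurable E -> G (xi @^-1` E).
Proof.
have GE := measurable_g_measurableTypeE sG.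
split=> [mx E mE|h _ E mE].
  by rewrite -GE -[X in measurable X]setTI; exact: mx.
by rewrite GE setTI; exact: h.
Qed.

Lemma gmeas_measurable xi : gmeas xi -> measurable_fun setT xi.
Proof.
move=> /gmeasP h _ E mE; rewrite setTI.
by apply: Gm; exact: h.
Qed.

Lemma gmeas_indic A : G A -> gmeas \1_A.
Proof.
move=> GA; apply: measurable_indic.
by rewrite (measurable_g_measurableTypeE sG).
Qed.

Lemma gmeas_setge xi x : gmeas xi -> G [set w | x <= xi w].
Proof.
move=> /gmeasP/(_ `[x, +oo[%classic (measurable_itv _)).
by congr G; apply/seteqP; split => w /=; rewrite in_itv/= andbT.
Qed.

(* [xi] is approximated uniformly by finite combinations of indicators of
   level sets. *)
Lemma freezing_ge0 xi g m K : gmeas xi -> 0 < K -> (forall w, 0 <= xi w <= K) ->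
  intg P g -> (forall A, G A -> \int[P]_(w in A) g w = m * fine (P A)) ->
  \int[P]_w (xi w * g w) = m * \int[P]_w xi w.
Proof.
move=> mxi K0 xiK ig gm; apply/eqP; rewrite -subr_eq0; apply/eqP.
have mxi' := gmeas_measurable mxi.
have xi_norm w : `|xi w| <= K.
  by case/andP: (xiK w) => x0 xK; rewrite ger0_norm.
have ixi : intg P xi := intg_bounded P mxi' xi_norm.
pose C := \int[P]_w `|g w| + `|m|.
apply: (@eq0_small _ _ C K) => // e /andP[e0 eK].
have [n] : exists n : nat, K / e < n%:R.
  by exists (Num.trunc (K / e)).+1; exact: truncnS_gt.
rewrite ltr_pdivrMr// => Kne.
have n0 : (0 < n)%N by rewrite lt0n; apply/eqP => n0; move: Kne; rewrite n0 mul0r; lra.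
have n0' : 0 < n%:R :> R by rewrite ltr0n.
pose c := K / n%:R.
have c0 : 0 < c by rewrite divr_gt0.
have ce : c <= e by rewrite ler_pdivrMr// mulrC ltW.
pose A k := [set w | k.+1%:R * c <= xi w].
have GA k : G (A k) by exact: gmeas_setge.
pose s w := \sum_(k < n) (c * \1_(A k) w).
have sxi w : `|xi w - s w| <= c.
  pose y := xi w / c.
  have yE : xi w = c * y by rewrite mulrC divfK// gt_eqF.
  have sE : s w = c * \sum_(k < n) ((k.+1%:R : R) <= y)%R%:R.
    rewrite mulr_sumr; apply: eq_bigr => k _; congr (_ * _).
    rewrite indicE ler_pdivlMr//; congr (nat_of_bool _)%:R.
    by apply/idP/idP; rewrite inE.
  have /andP[x0 xK] := xiK w.
  have /sum_steps_bounds : 0 <= y <= n%:R.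
    rewrite divr_ge0 ?(ltW c0)//= ler_pdivrMr// mulrC.
    by rewrite /c divfK// gt_eqF.
  rewrite -(ler_pM2l c0) -(ler_pM2l c0 _ y) -sE -yE mulrBr mulr1 -yE => /andP[h1 h2].
  by rewrite ger0_norm; lra.
have mA k : measurable (A k) by exact/Gm.
have ii k : intg P (\1_(A k) : T -> R).
  by apply: (@intg_bounded _ _ _ _ _ 1); [exact: measurable_indic|exact: indic_bound].
have is_ k : intg P (fun w => c * \1_(A k) w) by exact: intgZ.
have isg k : intg P (fun w => c * (\1_(A k) w * g w)).
  by apply: intgZ; exact: intg_indic.
have [isum Is] := Rint_sum n is_.
have [isg' Isg] := Rint_sum n isg.
have sgE w : s w * g w = \sum_(k < n) (c * (\1_(A k) w * g w)).
  by rewrite mulr_suml; apply: eq_bigr => k _; rewrite mulrA.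
have Esg : \int[P]_w (s w * g w) = m * \int[P]_w s w.
  under eq_Rintegral do rewrite sgE.
  rewrite Isg /s Is mulr_sumr; apply: eq_bigr => k _.
  rewrite (RintegralZl _ measurableT (ii k)).
  rewrite (RintegralZl _ measurableT (intg_indic (mA k) ig)).
  by rewrite Rint_indic gm// Rint_P// mulrCA.
have ixig : intg P (fun w => xi w * g w) by exact: intgM_bounded mxi' xi_norm ig.
have isg'' : intg P (fun w => s w * g w) by rewrite (funext sgE).
(* The step function [s] satisfies the identity exactly, so only [xi - s], which is at most [c <= e]
   in absolute value, contributes. *)
have -> : \int[P]_w (xi w * g w) - m * \int[P]_w xi w =
  \int[P]_w ((xi w - s w) * g w) - m * \int[P]_w (xi w - s w).
  rewrite (_ : \int[P]_w ((xi w - s w) * g w) =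
      \int[P]_w (xi w * g w) - \int[P]_w (s w * g w)).
    by rewrite RintegralB// Esg mulrBr; lra.
  by rewrite -RintegralB//; apply: eq_Rintegral => w _; rewrite mulrBl.
have idg : intg P (fun w => (xi w - s w) * g w).
  rewrite (_ : (fun w => _) = (fun w => xi w * g w - s w * g w)); first exact: intgB.
  by apply/funext => w; rewrite mulrBl.
have ing : intg P (fun w => `|g w|) by exact: integrable_norm.
have id_ : intg P (fun w => xi w - s w) by exact: intgB.
have ind : intg P (fun w => `|xi w - s w|) by exact: integrable_norm.
rewrite (le_trans (ler_normB _ _))// /C mulrDr lerD//.
  rewrite (le_trans (le_normr_Rintegral _ idg))// -RintegralZl//.
  apply: le_Rint => //; [exact: integrable_norm|exact: intgZ|move=> w].
  by rewrite normrM ler_wpM2r// (le_trans (sxi w)).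
rewrite normrM mulrC ler_wpM2r//.
rewrite (le_trans (le_normr_Rintegral _ id_))//.
apply: (@le_trans _ _ (\int[P]_w e)).
  by apply: le_Rint => //; [exact: intg_cst|move=> w; exact: le_trans (sxi w) ce].
by rewrite Rint_cst.
Qed.

Lemma freezing xi g m K : gmeas xi -> (forall w, `|xi w| <= K) ->
  intg P g -> (forall A, G A -> \int[P]_(w in A) g w = m * fine (P A)) ->
  \int[P]_w (xi w * g w) = m * \int[P]_w xi w.
Proof.
move=> mxi xiK ig gm.
have K0 : 0 <= K by exact: le_trans (xiK point).
have K1 : 0 < 2 * K + 1 by lra.
have mxi' : gmeas (fun w => xi w + K) by exact: measurable_funD.
have xi'K w : 0 <= xi w + K <= 2 * K + 1.
  by have := xiK w; rewrite ler_norml => /andP[h1 h2]; apply/andP; split; lra.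
have ixi : intg P xi := intg_bounded P (gmeas_measurable mxi) xiK.
have := freezing_ge0 mxi' K1 xi'K ig gm.
rewrite RintegralD//; last exact: intg_cst.
under eq_Rintegral do rewrite mulrDl.
rewrite RintegralD//; last 2 first.
- exact: intgM_bounded (gmeas_measurable mxi) xiK ig.
- exact: intgZ.
(* On the whole space the hypothesis says that [g] has mean [m], so the shift of [xi] by [K] adds
   [m * K] to both sides and cancels. *)
have /gm : G setT by rewrite -setC0 -setTD; case: sG => g0 gD _; exact: gD.
rewrite RintegralZl// (_ : fine _ = 1) ?mulr1 => [->|]; last first.
  by rewrite -[LHS]mul1r -(Rintegral_cst P measurableT) Rint_cst.
by rewrite Rint_cst mulrDr (mulrC K); exact: addIr.
Qed.

End Freezing.

(** * Conditional moments from the moment generating function *)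

Section GaussianMoments.
Context {d : measure_display} {T : measurableType d} {R : realType}.
Variable P : probability T R.
Variable G : set (set T).
Hypothesis sG : sigma_algebra setT G.
Hypothesis Gm : G `<=` measurable.
Variables (W : T -> R) (v : R).
Hypothesis mW : measurable_fun setT W.
Hypothesis v0 : 0 <= v.
Hypothesis mgfW : forall A, G A -> forall u : R,
  (\int[P]_(w in A) (expR (u * W w))%:E = P A * (expR (v / 2 * u ^+ 2))%:E)%E.

Let GT : G setT.
Proof. by rewrite -setC0 -setTD; case: sG => g0 gD _; exact: gD. Qed.

Lemma intg_mgf u : intg P (fun w => expR (u * W w)).
Proof.
apply/integrableP; split.
  apply/measurable_EFinP; apply: measurableT_comp; first exact: measurable_expR.
  exact: measurable_funM.
under eq_integral do rewrite /= ger0_norm ?expR_ge0//.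
by rewrite mgfW// lte_mul_pinfty// ?ltry// fin_num_measure.
Qed.

Lemma Rint_mgf A u : G A ->
  \int[P]_(w in A) expR (u * W w) = fine (P A) * expR (v / 2 * u ^+ 2).
Proof. by move=> GA; rewrite /Rintegral mgfW// fineM// fin_num_measure//; exact: Gm. Qed.

Let ch u w := expR (u * W w) + expR (- u * W w).

Let intg_ch u : intg P (ch u).
Proof. by apply: intgD; exact: intg_mgf. Qed.

Lemma intg_moment4 : intg P (fun w => W w ^+ 4).
Proof.
apply: (@intg_dom _ _ _ _ _ (fun w => 24 * ch 1 w)); last exact: intgZ.
  exact: measurable_funX.
move=> w; rewrite ger0_norm; last by rewrite -[4%N]/(2 * 2)%N exprM sqr_ge0.
have := quartic_le_cosh (W w); rewrite /ch mul1r mulN1r.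
by have := sqr_ge0 (W w); lra.
Qed.

Lemma intg_moment2 : intg P (fun w => W w ^+ 2).
Proof.
apply: (@intg_dom _ _ _ _ _ (ch 1)) => //; first exact: measurable_funX.
move=> w; rewrite ger0_norm ?sqr_ge0//.
have := quartic_le_cosh (W w); rewrite /ch mul1r mulN1r.
by have := sqr_ge0 (W w ^+ 2); rewrite -exprM; lra.
Qed.

Lemma intg_moment1 : intg P W.
Proof.
apply: (@intg_dom _ _ _ _ _ (ch 1)) => //.
move=> w; rewrite /ch mul1r mulN1r (le_trans _ (expR_norm_le _))//.
by have := expR_ge1Dx `|W w|; lra.
Qed.

Let on A f : measurable A -> intg P f -> P.-integrable A (EFin \o f).
Proof. by move=> mA; apply: integrableS. Qed.

(** Second-order expansion at [0] of the moment generating function over [A]. The remainder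
    [|e W|^3 exp |e W|] is at most [6 |e|^3 exp (2 |W|)], whose integrable majorant is [ch 2]. *)
Let taylor_bound A e : G A -> -1 <= e <= 1 ->
  `|fine (P A) * (expR (v / 2 * e ^+ 2) - 1) - e * \int[P]_(w in A) W w
    - e ^+ 2 / 2 * \int[P]_(w in A) (W w ^+ 2)|
  <= `|e| ^+ 3 * (6 * \int[P]_(w in A) ch 2 w).
Proof.
move=> GA e1; have mA := Gm GA.
have e1' : `|e| <= 1 by rewrite ler_norml.
have i1 := on mA (intg_mgf e).
have i2 := on mA (intg_cst P 1).
have i3 := on mA (intgZ e intg_moment1).
have i4 := on mA (intgZ (e ^+ 2 / 2) intg_moment2).
have i12 := on mA (intgB (intg_mgf e) (intg_cst P 1)).
have i123 := on mA (intgB (intgB (intg_mgf e) (intg_cst P 1)) (intgZ e intg_moment1)).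
have i1234 := on mA (intgB (intgB (intgB (intg_mgf e) (intg_cst P 1))
  (intgZ e intg_moment1)) (intgZ (e ^+ 2 / 2) intg_moment2)).
have -> : fine (P A) * (expR (v / 2 * e ^+ 2) - 1) - e * \int[P]_(w in A) W w
    - e ^+ 2 / 2 * \int[P]_(w in A) (W w ^+ 2) =
  \int[P]_(w in A) (expR (e * W w) - 1 - e * W w - e ^+ 2 / 2 * W w ^+ 2).
  rewrite (RintegralB mA i123 i4) (RintegralB mA i12 i3) (RintegralB mA i1 i2).
  rewrite (RintegralZl _ mA (on mA intg_moment1)) (RintegralZl _ mA (on mA intg_moment2)).
  by rewrite Rint_mgf// Rintegral_cst// mul1r mulrBr mulr1.
rewrite (le_trans (le_normr_Rintegral mA i1234))// mulrA.
rewrite -(RintegralZl _ mA (on mA (intg_ch 2))).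
apply: le_Rintegral => //.
- exact: (integrable_norm i1234).
- by apply: (on mA); apply: intgZ; exact: intg_ch.
move=> w _.
rewrite (_ : e ^+ 2 / 2 * W w ^+ 2 = (e * W w) ^+ 2 / 2); last by field.
apply: (le_trans (expR_taylor2_norm _)).
rewrite normrM exprMn -(mulrA (`|e| ^+ 3)) -(mulrA (`|e| ^+ 3)) ler_wpM2l ?exprn_ge0//.
have h1 : expR (`|e| * `|W w|) <= expR `|W w| by rewrite ler_expR ler_piMl.
have h2 := cube_le_expR (normr_ge0 (W w)).
apply: (@le_trans _ _ (6 * expR `|W w| * expR `|W w|)).
  by apply: ler_pM; rewrite ?exprn_ge0 ?expR_ge0.
have -> : 6 * expR `|W w| * expR `|W w| = 6 * expR `|2 * W w|.
  by rewrite -mulrA -expRD normrM (ger0_norm (ler0n R 2)); congr (_ * expR _); ring.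
by rewrite ler_pM2l// /ch mulNr expR_norm_le.
Qed.

(** The constant and second-order terms of the expansion are even in [e]: comparing [e] with [- e]
    isolates [e] times the first moment, up to [O(e ^+ 3)]. *)
Lemma Rint_moment1 A : G A -> \int[P]_(w in A) W w = 0.
Proof.
move=> GA; apply: (@eq0_small _ _ (6 * \int[P]_(w in A) ch 2 w) 1) => //.
move=> e /andP[e0 e1].
have h1 : -1 <= e <= 1 by apply/andP; split; lra.
have h2 : -1 <= - e <= 1 by apply/andP; split; lra.
have := taylor_bound GA h1; have := taylor_bound GA h2.
rewrite sqrrN normrN (gtr0_norm e0).
set p := fine _ * _; set m1 := \int[P]_(w in A) W w.
set m2 := \int[P]_(w in A) _; set C := 6 * _.
rewrite !ler_norml => /andP[a1 a2] /andP[b1 b2].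
have C0 : 0 <= C by rewrite mulr_ge0// Rintegral_ge0// => w _; rewrite addr_ge0// expR_ge0.
have h : e ^+ 3 * C <= e * (e * C).
  by rewrite exprS -mulrA ler_pM2l// expr2 -mulrA ler_pM2l// ler_piMl.
apply/andP; split.
  by rewrite -(ler_pM2l e0); lra.
by rewrite -(ler_pM2l e0); lra.
Qed.

(** With the first moment gone, the expansion divided by [e ^+ 2] compares half the second moment
    with half of [v * fine (P A)], up to [O(e)]. *)
Lemma Rint_moment2 A : G A -> \int[P]_(w in A) (W w ^+ 2) = v * fine (P A).
Proof.
move=> GA; have v0' := v0; apply/eqP; rewrite -subr_eq0; apply/eqP.
set C := 6 * \int[P]_(w in A) ch 2 w.
have C0 : 0 <= C by rewrite mulr_ge0// Rintegral_ge0// => w _; rewrite addr_ge0// expR_ge0.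
have p0 : 0 <= fine (P A) by rewrite fine_ge0.
(* For [e <= e0] one has [e <= 1] and [v * e <= 1], so [y = v * e ^+ 2 / 2] is in the range of
   [expR_le_quadratic]. *)
pose e0 := (1 + v)^-1.
have v10 : 0 < 1 + v by rewrite ltr_pwDl.
have e00 : 0 < e0 by rewrite invr_gt0.
have e01 : e0 <= 1 by rewrite invf_le1 ?lerDl.
have e0E : e0 * (1 + v) = 1 by rewrite mulVf// gt_eqF.
clearbody e0.
apply: (@eq0_small _ _ (2 * C + fine (P A) * v ^+ 2) e0) => //.
move=> e /andP[e_gt0 ee0].
have h1 : -1 <= e <= 1 by apply/andP; split; lra.
have := taylor_bound GA h1; rewrite -/C Rint_moment1// mulr0 subr0 (gtr0_norm e_gt0).
have ve : v * e <= 1.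
  by rewrite (le_trans (ler_wpM2l v0 ee0))// -e0E mulrC ler_pM2l// lerDr.
set y := v / 2 * e ^+ 2.
have y0 : 0 <= y by rewrite mulr_ge0 ?sqr_ge0//; lra.
have e2 : 0 < e ^+ 2 by rewrite exprn_gt0.
have y1 : y <= 1 / 2.
  have yE : y = v * e * e / 2 by rewrite /y; field.
  have : v * e * e <= e by exact: ler_piMl (ltW e_gt0) ve.
  have := le_trans ee0 e01; rewrite yE => h2 h3; lra.
have yy : 0 <= y <= 1 / 2 by rewrite y0 y1.
have := expR_le_quadratic yy; have := expR_ge1Dx y.
set E := expR y => E1 E2.
set m2 := \int[P]_(w in A) _; set p := fine (P A) in p0 *.
have pE : p * (E - 1 - y) <= p * (2 * y ^+ 2) by rewrite ler_wpM2l//; lra.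
have pE0 : 0 <= p * (E - 1 - y) by rewrite mulr_ge0//; lra.
have yE : y ^+ 2 = v ^+ 2 / 4 * e ^+ 2 * e ^+ 2 by rewrite /y; field.
rewrite ler_norml ler_norml => /andP[a1 a2].
have e3 : e ^+ 3 * C = e ^+ 2 * (e * C) by ring.
have pv0 : 0 <= p * v ^+ 2 by rewrite mulr_ge0// sqr_ge0.
have h2 : p * (2 * y ^+ 2) <= e ^+ 2 * (e * (p * v ^+ 2) / 2).
  rewrite yE (_ : p * _ = e ^+ 2 * (e * (e * (p * v ^+ 2)) / 2)); last by field.
  by rewrite ler_pM2l// ler_pM2r// ler_pM2l// ler_piMl//; lra.
have h3 : p * (E - 1) = p * (E - 1 - y) + e ^+ 2 * (v * p / 2) by rewrite /y; field.
apply/andP; split; rewrite -(ler_pM2l e2); lra.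
Qed.

(** Integrating [quartic_le_cosh] gives [24 * (2 * expR (v / 2) - 2 - v)], which is of order
    [v ^+ 2]. The sharp constant [3] would bring nothing: only the order matters. *)
Lemma Rint_moment4 : v <= 1 -> \int[P]_w (W w ^+ 4) <= 24 * v ^+ 2.
Proof.
move=> v1; have v0' := v0.
have i1 := intg_mgf 1; have i2 := intg_mgf (-1).
have i3 : intg P (fun w => expR (1 * W w) + expR (-1 * W w)) := intgD i1 i2.
have i4 := intgB i3 (intg_cst P 2).
have i5 := intgB i4 intg_moment2.
apply: (@le_trans _ _ (\int[P]_w (24 * (expR (1 * W w) + expR (-1 * W w) - 2 - W w ^+ 2)))).
  apply: le_Rint; [exact: intg_moment4|exact: intgZ|move=> w].
  by have := quartic_le_cosh (W w); rewrite mul1r mulN1r; lra.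
rewrite (RintegralZl _ measurableT i5) ler_pM2l//.
rewrite (RintegralB measurableT i4 intg_moment2).
rewrite (RintegralB measurableT i3 (intg_cst P 2)) (RintegralD measurableT i1 i2).
rewrite !Rint_mgf// Rint_cst Rint_moment2// sqrrN expr1n mulr1.
have -> : fine (P setT) = 1.
  by rewrite -[LHS]mul1r -(Rintegral_cst P measurableT) Rint_cst.
have vv : 0 <= v / 2 <= 1 / 2 by apply/andP; split; lra.
have := expR_le_quadratic vv.
by rewrite expr_div_n; lra.
Qed.

End GaussianMoments.

(** * Moments of a correlated pair of increments *)

Section Increments.
Context {d : measure_display} {T : measurableType d} {R : realType}.
Variable P : probability T R.
Variable G : set (set T).
Hypothesis sG : sigma_algebra setT G.
Hypothesis Gm : G `<=` measurable.
Variables (b c : T -> R) (rho h : R).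
Hypothesis mb : measurable_fun setT b.
Hypothesis mc : measurable_fun setT c.
Hypothesis rho1 : -1 <= rho.
Hypothesis h01 : 0 <= h <= 1.
Hypothesis mgf_bc : forall A, G A -> forall u1 u2 : R,
  (\int[P]_(w in A) (expR (u1 * b w + u2 * c w))%:E
   = P A * (expR (h / 2 * (u1 ^+ 2 + 2 * rho * u1 * u2 + u2 ^+ 2)))%:E)%E.

Let h0 : 0 <= h. Proof. by case/andP: h01. Qed.
Let h1 : h <= 1. Proof. by case/andP: h01. Qed.

Lemma mgf_fst A : G A -> forall u : R,
  (\int[P]_(w in A) (expR (u * b w))%:E = P A * (expR (h / 2 * u ^+ 2))%:E)%E.
Proof.
move=> GA u; have := mgf_bc GA u 0.
under eq_integral do rewrite mul0r addr0.
by rewrite mulr0 expr0n/= !addr0.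
Qed.

Lemma mgf_snd A : G A -> forall u : R,
  (\int[P]_(w in A) (expR (u * c w))%:E = P A * (expR (h / 2 * u ^+ 2))%:E)%E.
Proof.
move=> GA u; have := mgf_bc GA 0 u.
under eq_integral do rewrite mul0r add0r.
by rewrite mulr0 mul0r expr0n/= !add0r.
Qed.

(** The sum has variance [h * (2 + 2 * rho)], nonnegative since [-1 <= rho]; polarization then
    yields the mixed moment from three second moments. *)
Lemma mgf_add A : G A -> forall u : R,
  (\int[P]_(w in A) (expR (u * (b w + c w)))%:E =
   P A * (expR ((h * (2 + 2 * rho)) / 2 * u ^+ 2))%:E)%E.
Proof.
move=> GA u; have := mgf_bc GA u u.
under eq_integral do rewrite -mulrDr.
by move=> ->; congr (_ * (expR _)%:E)%E; field.
Qed.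

Let v0 : 0 <= h * (2 + 2 * rho).
Proof. by rewrite mulr_ge0//; have := rho1; lra. Qed.

Let mbc : measurable_fun setT (fun w => b w + c w).
Proof. exact: measurable_funD. Qed.

Let prodE w : b w * c w = 1 / 2 * ((b w + c w) ^+ 2 - b w ^+ 2 - c w ^+ 2).
Proof. by field. Qed.

Lemma intg_prod : intg P (fun w => b w * c w).
Proof.
rewrite (funext prodE); apply: intgZ; apply: intgB; first apply: intgB.
- exact: (intg_moment2 sG mbc mgf_add).
- exact: (intg_moment2 sG mb mgf_fst).
- exact: (intg_moment2 sG mc mgf_snd).
Qed.

Lemma Rint_prod A : G A ->
  \int[P]_(w in A) (b w * c w) = rho * h * fine (P A).
Proof.
move=> GA; have mA := Gm GA.
have i1 := intg_moment2 sG mbc mgf_add.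
have i2 := intg_moment2 sG mb mgf_fst.
have i3 := intg_moment2 sG mc mgf_snd.
have on f : intg P f -> P.-integrable A (EFin \o f) by apply: integrableS.
under eq_Rintegral do rewrite prodE.
rewrite (RintegralZl _ mA (on _ (intgB (intgB i1 i2) i3))).
rewrite (RintegralB mA (on _ (intgB i1 i2)) (on _ i3)) (RintegralB mA (on _ i1) (on _ i2)).
rewrite (Rint_moment2 sG Gm mbc v0 mgf_add GA) (Rint_moment2 sG Gm mb h0 mgf_fst GA).
by rewrite (Rint_moment2 sG Gm mc h0 mgf_snd GA); field.
Qed.

(** Freezing replaces each monomial in the increments by its conditional moment: linear terms
    vanish, the squares give [h], the product [rho * h], and each fourth power costs at most
    [24 * h ^+ 2]. *)
Lemma Rint_quadratic (x0 x1 x2 x3 x4 x5 : T -> R) (K C : R) : 0 <= C ->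
  gmeas G x0 -> gmeas G x1 -> gmeas G x2 -> gmeas G x3 -> gmeas G x4 -> gmeas G x5 ->
  (forall w, `|x0 w| <= K) -> (forall w, `|x1 w| <= K) -> (forall w, `|x2 w| <= K) ->
  (forall w, `|x3 w| <= K) -> (forall w, `|x4 w| <= K) -> (forall w, `|x5 w| <= K) ->
  let Q w := x0 w + x1 w * b w + x2 w * c w + x3 w * b w ^+ 2 + x4 w * c w ^+ 2
      + x5 w * (b w * c w) + C * (b w ^+ 4 + c w ^+ 4) in
  intg P Q /\
  \int[P]_w Q w <= \int[P]_w (x0 w + h * x3 w + h * x4 w + rho * h * x5 w)
    + 48 * C * h ^+ 2.
Proof.
move=> C0 m0 m1 m2 m3 m4 m5 K0 K1 K2 K3 K4 K5 Q.
have M := gmeas_measurable sG Gm.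
have i0 := intg_bounded P (M _ _ m0) K0.
have i1 := intg_bounded P (M _ _ m1) K1.
have i2 := intg_bounded P (M _ _ m2) K2.
have i3 := intg_bounded P (M _ _ m3) K3.
have i4 := intg_bounded P (M _ _ m4) K4.
have i5 := intg_bounded P (M _ _ m5) K5.
have b1 := intg_moment1 sG mb mgf_fst.
have b2 := intg_moment2 sG mb mgf_fst.
have b4 := intg_moment4 sG mb mgf_fst.
have c1 := intg_moment1 sG mc mgf_snd.
have c2 := intg_moment2 sG mc mgf_snd.
have c4 := intg_moment4 sG mc mgf_snd.
have bc := intg_prod.
have j1 := intgM_bounded (M _ _ m1) K1 b1.
have j2 := intgM_bounded (M _ _ m2) K2 c1.
have j3 := intgM_bounded (M _ _ m3) K3 b2.
have j4 := intgM_bounded (M _ _ m4) K4 c2.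
have j5 := intgM_bounded (M _ _ m5) K5 bc.
have j6 := intgZ C (intgD b4 c4).
have k1 := intgD i0 j1.
have k2 := intgD k1 j2.
have k3 := intgD k2 j3.
have k4 := intgD k3 j4.
have k5 := intgD k4 j5.
have k6 := intgD k5 j6.
split; first exact: k6.
rewrite /Q (RintegralD measurableT k5 j6) (RintegralD measurableT k4 j5).
rewrite (RintegralD measurableT k3 j4) (RintegralD measurableT k2 j3).
rewrite (RintegralD measurableT k1 j2) (RintegralD measurableT i0 j1).
rewrite (freezing sG Gm m1 K1 b1 (m := 0)); last first.
  by move=> A GA; rewrite (Rint_moment1 sG Gm mb mgf_fst GA) mul0r.
rewrite (freezing sG Gm m2 K2 c1 (m := 0)); last first.
  by move=> A GA; rewrite (Rint_moment1 sG Gm mc mgf_snd GA) mul0r.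
rewrite (freezing sG Gm m3 K3 b2 (Rint_moment2 sG Gm mb h0 mgf_fst)).
rewrite (freezing sG Gm m4 K4 c2 (Rint_moment2 sG Gm mc h0 mgf_snd)).
rewrite (freezing sG Gm m5 K5 bc Rint_prod).
rewrite (RintegralZl _ measurableT (intgD b4 c4)) (RintegralD measurableT b4 c4).
have l3 := intgZ h i3; have l4 := intgZ h i4; have l5 := intgZ (rho * h) i5.
rewrite (RintegralD measurableT (intgD (intgD i0 l3) l4) l5).
rewrite (RintegralD measurableT (intgD i0 l3) l4) (RintegralD measurableT i0 l3).
rewrite (RintegralZl _ measurableT i3) (RintegralZl _ measurableT i4).
rewrite (RintegralZl _ measurableT i5).
have B4 := Rint_moment4 sG Gm mb h0 mgf_fst h1.
have C4 := Rint_moment4 sG Gm mc h0 mgf_snd h1.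
have : C * (\int[P]_w (b w ^+ 4) + \int[P]_w (c w ^+ 4)) <= C * (48 * h ^+ 2).
  by rewrite ler_wpM2l//; lra.
lra.
Qed.

End Increments.

(** * Deterministic estimates for one logarithmic step *)

Section PointwiseStep.
Context {R : realType}.
Variables (K th : R).
Implicit Types (S p q s m g b c h rho : R).

(** With [D1] of order one and [D2] of order two in the increments, only [D1 ^+ 2 / 2] is kept. The
    terms [D1 * D2], [D2 ^+ 2 / 2] and the cubic remainder are at most [2], [3 / 2] and [50] times
    [K ^+ 3 * r * N]; the sum stays below [60 * K ^+ 3 * r * N = th * N], which explains the
    radius. *)
Lemma log_step_taylor p q s m b c h : 1 <= K -> 0 < th <= 1 ->
  `|p| <= K -> `|q| <= K -> `|s| <= K -> `|m| <= K ->
  `|b| <= th / (60 * K ^+ 3) -> `|c| <= th / (60 * K ^+ 3) ->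
  0 <= h <= th / (60 * K ^+ 3) ->
  - ln (1 + (p * b + q * c + s * (b ^+ 2 + c ^+ 2) + m * h)) <=
  - (p * b + q * c + s * (b ^+ 2 + c ^+ 2) + m * h) + (p * b + q * c) ^+ 2 / 2
  + th * (b ^+ 2 + c ^+ 2 + h).
Proof.
move=> K1 /andP[th0 th1] pK qK sK mK.
set r := th / _ => br cr /andP[h0 hr].
have K0 : 0 < K by lra.
have r0 : 0 <= r by exact: le_trans (normr_ge0 b) br.
have K3r : 60 * (K ^+ 3 * r) = th.
  by rewrite /r; field; rewrite gt_eqF.
have K2 : K <= K ^+ 2 by rewrite expr2 ler_peMr//; lra.
have K23 : K ^+ 2 <= K ^+ 3 by rewrite [leRHS]exprS ler_peMl ?sqr_ge0.
have Kr : 60 * (K * r) <= 1.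
  rewrite (le_trans _ th1)// -K3r ler_pM2l// ler_wpM2r//; lra.
have K2r : 60 * (K ^+ 2 * r) <= th.
  by rewrite -K3r ler_pM2l// ler_wpM2r.
have r1 : r <= 1.
  by have : 1 * r <= K * r by [rewrite ler_wpM2r]; lra.
set N := b ^+ 2 + c ^+ 2 + h.
have b2 := sqr_ge0 b; have c2 := sqr_ge0 c.
have N0 : 0 <= N by rewrite /N; lra.
have b2r : b ^+ 2 <= r.
  by rewrite -real_normK ?num_real// expr2 -[leRHS]mulr1 ler_pM//; lra.
have c2r : c ^+ 2 <= r.
  by rewrite -real_normK ?num_real// expr2 -[leRHS]mulr1 ler_pM//; lra.
have N3r : N <= 3 * r by rewrite /N; lra.
set D1 := p * b + q * c; set D2 := s * (b ^+ 2 + c ^+ 2) + m * h.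
have -> : p * b + q * c + s * (b ^+ 2 + c ^+ 2) + m * h = D1 + D2.
  by rewrite /D1 /D2; ring.
have D1r : `|D1| <= 2 * (K * r).
  rewrite (le_trans (ler_normD _ _))// !normrM.
  have : `|p| * `|b| <= K * r by rewrite ler_pM.
  have : `|q| * `|c| <= K * r by rewrite ler_pM.
  lra.
have D2N : `|D2| <= K * N.
  rewrite (le_trans (ler_normD _ _))// !normrM /N mulrDr.
  rewrite (ger0_norm h0) (ger0_norm (_ : 0 <= b ^+ 2 + c ^+ 2)); last lra.
  by rewrite lerD// ler_wpM2r//; lra.
have KN : K * N <= 3 * (K * r).
  by rewrite (le_trans (ler_wpM2l (ltW K0) N3r))//; lra.
have D1N : D1 ^+ 2 <= 2 * (K ^+ 2 * N).
  have h1 : D1 ^+ 2 <= 2 * ((p * b) ^+ 2 + (q * c) ^+ 2).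
    by have := sqr_ge0 (p * b - q * c); rewrite /D1 sqrrB (sqrrD (p * b)); lra.
  have sqK t : `|t| <= K -> t ^+ 2 <= K ^+ 2.
    by move=> tK; rewrite -[t ^+ 2]real_normK ?num_real// lerXn2r ?nnegrE//; lra.
  have : p ^+ 2 * b ^+ 2 <= K ^+ 2 * b ^+ 2 by rewrite ler_wpM2r ?sqK.
  have : q ^+ 2 * c ^+ 2 <= K ^+ 2 * c ^+ 2 by rewrite ler_wpM2r ?sqK.
  have : 0 <= K ^+ 2 * h by rewrite mulr_ge0// sqr_ge0.
  by rewrite !exprMn in h1; rewrite /N; lra.
have D2sq : D2 ^+ 2 <= K ^+ 2 * N * (3 * r).
  rewrite -real_normK ?num_real//.
  rewrite (_ : K ^+ 2 * N * (3 * r) = (K * N) * (K * (3 * r))); last by ring.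
  rewrite expr2 ler_pM// (le_trans D2N)//; lra.
have D12 : D1 * D2 <= 2 * (K ^+ 2 * r) * N.
  rewrite (le_trans (ler_norm _))// normrM.
  rewrite (_ : 2 * (K ^+ 2 * r) * N = (2 * (K * r)) * (K * N)); last by ring.
  by rewrite ler_pM.
have DD : `|D1 + D2| <= 5 * (K * r).
  by rewrite (le_trans (ler_normD _ _))//; lra.
have D14 : `|D1 + D2| <= 1 / 4 by lra.
rewrite (le_trans (opp_ln_taylor D14))//.
have KN2 : 0 <= K ^+ 2 * N by rewrite mulr_ge0// sqr_ge0.
have KNr : K ^+ 2 * N * (3 * r) <= 3 * (K ^+ 2 * N).
  by rewrite mulrC ler_wpM2r//; lra.
have Dsq : (D1 + D2) ^+ 2 <= 10 * (K ^+ 2 * N).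
  have := sqr_ge0 (D1 - D2); rewrite sqrrB (sqrrD D1 D2); lra.
have D3 : `|D1 + D2| ^+ 3 <= 50 * (K ^+ 3 * r) * N.
  rewrite exprS real_normK ?num_real//.
  rewrite (_ : 50 * (K ^+ 3 * r) * N = (5 * (K * r)) * (10 * (K ^+ 2 * N))); last by ring.
  by rewrite ler_pM ?sqr_ge0.
have t1 : (K ^+ 3 * r) * N <= th / 60 * N by rewrite ler_wpM2r//; lra.
have t2 : (K ^+ 2 * r) * N <= th / 60 * N by rewrite ler_wpM2r//; lra.
have t0 : 0 <= th * N by rewrite mulr_ge0// ltW.
rewrite (sqrrD D1); lra.
Qed.

(* Since [S >= 1], the upper bound of the step estimate stays nonnegative off the
   good event, so that event can be dropped before taking expectations. *)
Lemma log_step_ge0 S p q s m g b c h : 1 <= K -> 0 < th -> 1 <= S ->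
  `|p| <= K -> `|q| <= K -> `|s| <= K -> `|m| <= K -> `|g| <= K ->
  0 <= h <= 1 / (60 * K) ->
  0 <= S - (p * b + q * c + s * (b ^+ 2 + c ^+ 2) + m * h) - g * h
    + (p * b + q * c) ^+ 2 / 2 + th * (b ^+ 2 + c ^+ 2 + h)
    + 100 * K ^+ 4 * (b ^+ 4 + c ^+ 4).
Proof.
move=> K1 th0 S1 pK qK sK mK gK /andP[h0 hK].
have K0 : 0 < K by lra.
have Kh : K * h <= 1 / 60.
  by move: hK; rewrite ler_pdivlMr ?mulr_gt0//; lra.
(* Two completed squares: the first trades [K * |x|] for [1 / 16 + 4 * K ^+ 2 * x ^+ 2], the second
   trades [5 * K ^+ 2 * x ^+ 2] for [1 / 16 + 100 * K ^+ 4 * x ^+ 4]. This fixes the coefficient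
   [100 * K ^+ 4]. *)
have key x : K * `|x| + K * x ^+ 2 <= 1 / 8 + 100 * K ^+ 4 * x ^+ 4.
  have e1 : x ^+ 2 = `|x| ^+ 2 by rewrite real_normK ?num_real.
  have a1 : 0 <= 1 / 16 - K * `|x| + 4 * (K ^+ 2 * x ^+ 2).
    by rewrite e1 (_ : _ + _ = (1 / 4 - 2 * (K * `|x|)) ^+ 2) ?sqr_ge0//; field.
  have a2 : 0 <= 1 / 16 - 5 * (K ^+ 2 * x ^+ 2) + 100 * K ^+ 4 * x ^+ 4.
    by rewrite (_ : _ + _ = (1 / 4 - 10 * (K ^+ 2 * x ^+ 2)) ^+ 2) ?sqr_ge0//; field.
  have a3 : K * x ^+ 2 <= K ^+ 2 * x ^+ 2.
    by rewrite ler_wpM2r ?sqr_ge0// expr2 ler_peMr// ltW.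
  lra.
have ub u x : `|u| <= K -> u * x <= K * `|x|.
  by move=> uK; rewrite (le_trans (ler_norm _))// normrM ler_wpM2r.
have p1 := ub _ b pK; have q1 := ub _ c qK.
have s1 := ub _ (b ^+ 2 + c ^+ 2) sK.
rewrite (ger0_norm (addr_ge0 (sqr_ge0 b) (sqr_ge0 c))) in s1.
have m1 := ub _ h mK; have g1 := ub _ h gK.
rewrite (ger0_norm h0) in m1 g1.
have t1 : 0 <= th * (b ^+ 2 + c ^+ 2 + h).
  by rewrite mulr_ge0 ?(ltW th0)// !addr_ge0 ?sqr_ge0.
have := key b; have := key c; have := sqr_ge0 (p * b + q * c); lra.
Qed.

End PointwiseStep.

(** * Approximate supermartingale property of one step *)

Section OneStep.
Context {d : measure_display} {T : measurableType d} {R : realType}.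
Variable P : probability T R.
Variable G : set (set T).
Hypothesis sG : sigma_algebra setT G.
Hypothesis Gm : G `<=` measurable.

Lemma indic1 (A : set T) w : A w -> \1_A w = 1 :> R.
Proof. by move=> Aw; rewrite indicE mem_set. Qed.

Lemma indic0 (A : set T) w : ~ A w -> \1_A w = 0 :> R.
Proof. by move=> Aw; rewrite indicE memNset. Qed.

(** [A] is known at the start of the step, [A'] only at its end. The majorant [Q] depends on the
    past and on the increments but not on [A'], is nonnegative everywhere and dominates [S'] on
    [A'], so its mean can be computed by freezing. Of the error [5 * th * h], three parts come from
    [th * (b ^+ 2 + c ^+ 2 + h)], one from the drift hypothesis and one from the fourth moments, by
    the bound on [h]. *)
Lemma one_step (b c : T -> R) (rho h : R) (A A' : set T)
    (S S' p q s m g : T -> R) (K th : R) :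
  measurable_fun setT b -> measurable_fun setT c -> -1 <= rho ->
  (forall A, G A -> forall u1 u2 : R,
    (\int[P]_(w in A) (expR (u1 * b w + u2 * c w))%:E
     = P A * (expR (h / 2 * (u1 ^+ 2 + 2 * rho * u1 * u2 + u2 ^+ 2)))%:E)%E) ->
  G A -> measurable A' -> A' `<=` A ->
  gmeas G S -> gmeas G p -> gmeas G q -> gmeas G s -> gmeas G m -> gmeas G g ->
  measurable_fun setT S' ->
  1 <= K -> 0 < th <= 1 -> 0 <= h <= th / (48 * (100 * K ^+ 4)) ->
  (forall w, A w -> 1 <= S w <= K) ->
  (forall w, A w ->
    [/\ `|p w| <= K, `|q w| <= K, `|s w| <= K, `|m w| <= K & `|g w| <= K]) ->
  (forall w, A w -> - (2 * s w + m w + g w)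
    + 1 / 2 * (p w ^+ 2 + q w ^+ 2 + 2 * rho * p w * q w) <= th) ->
  (forall w, A' w -> [/\ 0 <= S' w, `|b w| <= th / (60 * K ^+ 3),
    `|c w| <= th / (60 * K ^+ 3) &
    S' w <= S w - ln (1 + (p w * b w + q w * c w
      + s w * (b w ^+ 2 + c w ^+ 2) + m w * h)) - g w * h]) ->
  intg P (fun w => \1_A' w * S' w) /\
  \int[P]_w (\1_A' w * S' w) <= \int[P]_w (\1_A w * S w) + 5 * th * h.
Proof.
move=> mb mc rho1 mgf GA mA' AA' gS gp gq gs gm_ gg mS' K1 /andP[th0 th1] /andP[h0 hK]
  SK pK drift step.
have K0 : 0 < K by lra.
have K2 : K <= K ^+ 2 by rewrite expr2 ler_peMr//; lra.
have K23 : K ^+ 2 <= K ^+ 3 by rewrite [leRHS]exprS ler_peMl ?sqr_ge0.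
have K34 : K ^+ 3 <= K ^+ 4 by rewrite [leRHS]exprS ler_peMl ?exprn_ge0// ltW.
have K4 : 0 < K ^+ 4 by rewrite exprn_gt0.
have hK4 : 48 * (100 * K ^+ 4) * h <= th.
  by move: hK; rewrite ler_pdivlMr ?mulr_gt0//; lra.
have Kh4 (k : R) : 0 < k -> k <= K ^+ 4 -> h <= th / (60 * k).
  move=> k0 kK; rewrite ler_pdivlMr ?mulr_gt0//.
  have : k * h <= K ^+ 4 * h by rewrite ler_wpM2r.
  have : 0 <= K ^+ 4 * h by rewrite mulr_ge0// ltW.
  lra.
have hr : 0 <= h <= th / (60 * K ^+ 3) by rewrite h0 Kh4// exprn_gt0.
have hr1 : 0 <= h <= 1 / (60 * K).
  rewrite h0/= (le_trans (Kh4 K _ _))//; first lra.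
  by rewrite ler_pM2r// invr_gt0 mulr_gt0.
have h1 : h <= 1.
  have : 1 * h <= K ^+ 4 * h by rewrite ler_wpM2r//; lra.
  lra.
(* Coefficients of the majorant as a polynomial in the increments; the indicator of [A] makes them
   bounded everywhere while keeping them measurable with respect to the past. *)
pose x0 w := \1_A w * (S w - m w * h - g w * h + th * h).
pose x1 w := \1_A w * - p w.
pose x2 w := \1_A w * - q w.
pose x3 w := \1_A w * (- s w + p w ^+ 2 / 2 + th).
pose x4 w := \1_A w * (- s w + q w ^+ 2 / 2 + th).
pose x5 w := \1_A w * (p w * q w).
pose K' := 3 * K + K ^+ 2 + 1.
have gA := gmeas_indic sG GA (R := R).
have gM (f1 f2 : T -> R) : gmeas G f1 -> gmeas G f2 -> gmeas G (fun w => f1 w * f2 w).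
  by move=> ? ?; exact: measurable_funM.
have gD (f1 f2 : T -> R) : gmeas G f1 -> gmeas G f2 -> gmeas G (fun w => f1 w + f2 w).
  by move=> ? ?; exact: measurable_funD.
have gN (f1 : T -> R) : gmeas G f1 -> gmeas G (fun w => - f1 w).
  by move=> ?; exact: measurable_funN.
have gC (k : R) : gmeas G (fun=> k) by exact: measurable_cst.
have g0 : gmeas G x0 := gM _ _ gA (gD _ _ (gD _ _ (gD _ _ gS
  (gN _ (gM _ _ gm_ (gC h)))) (gN _ (gM _ _ gg (gC h)))) (gC (th * h))).
have g1 : gmeas G x1 := gM _ _ gA (gN _ gp).
have g2 : gmeas G x2 := gM _ _ gA (gN _ gq).
have g3 : gmeas G x3 := gM _ _ gA (gD _ _ (gD _ _ (gN _ gs)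
  (gM _ _ (gM _ _ gp gp) (gC 2^-1))) (gC th)).
have g4 : gmeas G x4 := gM _ _ gA (gD _ _ (gD _ _ (gN _ gs)
  (gM _ _ (gM _ _ gq gq) (gC 2^-1))) (gC th)).
have g5 : gmeas G x5 := gM _ _ gA (gM _ _ gp gq).
have bnd w t : (A w -> `|t| <= K') -> `|\1_A w * t| <= K'.
  move=> tK; have [Aw|Aw] := pselect (A w); first by rewrite indic1// mul1r tK.
  by rewrite indic0// mul0r normr0 /K'; lra.
have sqK t : `|t| <= K -> 0 <= t ^+ 2 <= K ^+ 2.
  move=> tK; rewrite sqr_ge0/= -[t ^+ 2]real_normK ?num_real//.
  by rewrite lerXn2r ?nnegrE// ltW.
have mh t : `|t| <= K -> `|t * h| <= K.
  by move=> tK; rewrite normrM (ger0_norm h0) -[leRHS]mulr1 ler_pM.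
have thh : 0 <= th * h <= 1.
  by rewrite mulr_ge0 ?(ltW th0)//= -[leRHS]mulr1 ler_pM// ltW.
have k0 w : `|x0 w| <= K'.
  apply: (bnd w) => Aw; have [_ _ _ /mh + /mh] := pK w Aw.
  have /andP[S1 SK'] := SK w Aw; case/andP: thh => t0 t1.
  rewrite !ler_norml => /andP[? ?] /andP[? ?]; rewrite /K'.
  by apply/andP; split; lra.
have k1 w : `|x1 w| <= K'.
  by apply: (bnd w) => Aw; have [+ _ _ _ _] := pK w Aw; rewrite normrN /K'; lra.
have k2 w : `|x2 w| <= K'.
  by apply: (bnd w) => Aw; have [_ + _ _ _] := pK w Aw; rewrite normrN /K'; lra.
have k3 w : `|x3 w| <= K'.
  apply: (bnd w) => Aw; have [/sqK/andP[? ?] _ + _ _] := pK w Aw.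
  by rewrite !ler_norml /K' => /andP[? ?]; apply/andP; split; lra.
have k4 w : `|x4 w| <= K'.
  apply: (bnd w) => Aw; have [_ /sqK/andP[? ?] + _ _] := pK w Aw.
  by rewrite !ler_norml /K' => /andP[? ?]; apply/andP; split; lra.
have k5 w : `|x5 w| <= K'.
  apply: (bnd w) => Aw; have [p1 q1 _ _ _] := pK w Aw.
  have : `|p w * q w| <= K ^+ 2 by rewrite normrM expr2 ler_pM.
  by rewrite /K'; lra.
have C0 : 0 <= 100 * K ^+ 4 by rewrite mulr_ge0// ltW.
have h01 : 0 <= h <= 1 by rewrite h0.
have := Rint_quadratic sG Gm mb mc rho1 h01 mgf C0 g0 g1 g2 g3 g4 g5 k0 k1 k2 k3 k4 k5.
set Q := fun w => _ + _; cbv zeta => -[iQ IQ].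
have QE w : A w -> Q w = S w - (p w * b w + q w * c w
      + s w * (b w ^+ 2 + c w ^+ 2) + m w * h) - g w * h
    + (p w * b w + q w * c w) ^+ 2 / 2 + th * (b w ^+ 2 + c w ^+ 2 + h)
    + 100 * K ^+ 4 * (b w ^+ 4 + c w ^+ 4).
  by move=> Aw; rewrite /Q /x0 /x1 /x2 /x3 /x4 /x5 indic1//; field.
have fourth (x : R) : 0 <= x ^+ 4 by rewrite -[4%N]/(2 * 2)%N exprM sqr_ge0.
have Q4 w : 0 <= 100 * K ^+ 4 * (b w ^+ 4 + c w ^+ 4).
  by rewrite mulr_ge0// addr_ge0.
have Q0 w : 0 <= Q w.
  have [Aw|Aw] := pselect (A w); last first.
    by rewrite /Q /x0 /x1 /x2 /x3 /x4 /x5 indic0// !mul0r !add0r.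
  have [? ? ? ? ?] := pK w Aw; have /andP[? _] := SK w Aw.
  by rewrite QE//; apply: log_step_ge0.
have th01 : 0 < th <= 1 by rewrite th0.
have SQ w : 0 <= \1_A' w * S' w <= Q w.
  have [Aw'|Aw'] := pselect (A' w); last by rewrite indic0// mul0r lexx Q0.
  have [S0 br cr S'S] := step w Aw'; have Aw := AA' _ Aw'.
  rewrite indic1// mul1r S0 QE//=.
  have [? ? ? ? ?] := pK w Aw.
  have := @log_step_taylor _ K th (p w) (q w) (s w) (m w) (b w) (c w) h K1 th01.
  move=> /(_ _ _ _ _ br cr hr) l; have {}l := l _ _ _ _.
  have Q4w := Q4 w.
  have : - ln (1 + (p w * b w + q w * c w + s w * (b w ^+ 2 + c w ^+ 2) + m w * h)) <=
    - (p w * b w + q w * c w + s w * (b w ^+ 2 + c w ^+ 2) + m w * h)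
    + (p w * b w + q w * c w) ^+ 2 / 2 + th * (b w ^+ 2 + c w ^+ 2 + h) by apply: l.
  lra.
have iS' : intg P (fun w => \1_A' w * S' w).
  apply: (intg_dom _ _ iQ).
    by apply: measurable_funM => //; exact: measurable_indic.
  by move=> w; have /andP[a1 a2] := SQ w; rewrite ger0_norm.
split=> //.
have iS : intg P (fun w => \1_A w * S w).
  apply: (@intg_bounded _ _ _ _ _ K).
    by apply: measurable_funM; [exact/measurable_indic/Gm|exact: gmeas_measurable gS].
  move=> w; have [Aw|Aw] := pselect (A w); last by rewrite indic0// mul0r normr0 ltW.
  by rewrite indic1// mul1r; have /andP[a1 a2] := SK w Aw; rewrite ger0_norm//; lra.
apply: (@le_trans _ _ (\int[P]_w Q w)).
  by apply: le_Rint => // w; case/andP: (SQ w).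
apply: (le_trans IQ).
have -> : 5 * th * h = 4 * th * h + th * h by ring.
rewrite addrA lerD//; last first.
  have : h * (48 * (100 * K ^+ 4) * h) <= h * th by rewrite ler_wpM2l.
  by lra.
rewrite -{1}(Rint_cst P (4 * th * h)) -(RintegralD measurableT iS (intg_cst P _)).
have M := gmeas_measurable sG Gm.
apply: le_Rint.
- apply: intgD; first apply: intgD; first apply: intgD.
  + exact: intg_bounded (M _ _ g0) k0.
  + by apply: intgZ; exact: intg_bounded (M _ _ g3) k3.
  + by apply: intgZ; exact: intg_bounded (M _ _ g4) k4.
  + by apply: intgZ; exact: intg_bounded (M _ _ g5) k5.
- by apply: intgD => //; exact: intg_cst.
move=> w; rewrite /x0 /x3 /x4 /x5.
have [Aw|Aw] := pselect (A w); last first.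
  rewrite indic0// !mul0r !mulr0 !addr0 add0r.
  by case/andP: thh; lra.
rewrite indic1// !mul1r.
have : h * (- (2 * s w + m w + g w)
    + 1 / 2 * (p w ^+ 2 + q w ^+ 2 + 2 * rho * p w * q w)) <= h * th.
  by rewrite ler_wpM2l// drift.
lra.
Qed.

End OneStep.

(** * Maximal inequality and limits of events *)

Section HittingBound.
Context {d : measure_display} {T : measurableType d} {R : realType}.
Variable P : probability T R.

Lemma fine_P_le (A B : set T) : measurable A -> measurable B -> A `<=` B ->
  fine (P A) <= fine (P B).
Proof.
by move=> mA mB AB; rewrite fine_le ?fin_num_measure// le_measure ?inE.
Qed.

(** Discrete maximal inequality with killing: at step [k] the paths outside [A k] are discarded,
    those in [C k] are stopped with [S] at least [La], the others form [N k.+1]. Since [S] is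
    nonnegative, discarding cannot increase the mean. *)
Lemma hitting_bound (N A C : nat -> set T) (S : nat -> T -> R) (La e : R) (n : nat) :
  0 <= La ->
  (forall k, measurable (A k)) -> (forall k, measurable (C k)) ->
  (forall k, N k.+1 = A k `\` C k) -> measurable (N 0) ->
  (forall k w, A k w -> 0 <= S k.+1 w) ->
  (forall k w, A k w -> C k w -> La <= S k.+1 w) ->
  (forall k w, N k w -> 0 <= S k w) ->
  intg P (fun w => \1_(N 0) w * S 0 w) ->
  (forall k, (k < n)%N -> intg P (fun w => \1_(A k) w * S k.+1 w) /\
    \int[P]_w (\1_(A k) w * S k.+1 w) <= \int[P]_w (\1_(N k) w * S k w) + e) ->
  La * fine (P (\bigcup_(k in `I_n) (A k `&` C k))) <=
    \int[P]_w (\1_(N 0) w * S 0 w) + n%:R * e.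
Proof.
move=> La0 mA mC NE mN0 SA SC SN i0 step.
have mN k : measurable (N k) by case: k => // k; rewrite NE; exact: measurableD.
have mAC k : measurable (A k `&` C k) by exact: measurableI.
have mU m : measurable (\bigcup_(k in `I_m) (A k `&` C k)) by exact: bigcup_measurable.
(* The mean of [S] over the survivors is carried along to make the induction close, and dropped at
   the end by nonnegativity. *)
suff : forall m, (m <= n)%N ->
    La * fine (P (\bigcup_(k in `I_m) (A k `&` C k)))
    + \int[P]_w (\1_(N m) w * S m w) <=
    \int[P]_w (\1_(N 0) w * S 0 w) + m%:R * e.
  move=> /(_ n (leqnn n)); apply: le_trans; rewrite lerDl.
  apply: Rintegral_ge0 => w _.
  have [Nw|Nw] := pselect (N n w); first by rewrite indic1// mul1r SN.
  by rewrite indic0// mul0r.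
elim=> [_|m IH mn].
  have -> : \bigcup_(k in `I_0) (A k `&` C k) = set0.
    by rewrite -subset0 => w [k].
  by rewrite measure0/= mulr0 add0r mul0r addr0.
have {}IH := IH (ltnW mn).
have [iA IA] := step m mn.
have iN : intg P (fun w => \1_(N m.+1) w * S m.+1 w).
  rewrite (_ : (fun w => _) = fun w => \1_(N m.+1) w * (\1_(A m) w * S m.+1 w)).
    exact: intg_indic.
  apply/funext => w; have [Nw|Nw] := pselect (N m.+1 w); last by rewrite (indic0 Nw) !mul0r.
  by rewrite (indic1 Nw) (@indic1 _ _ _ (A m)) ?mul1r//; move: Nw; rewrite NE => -[].
have iH : intg P (fun w => La * \1_(A m `&` C m) w).
  apply: intgZ; apply: (@intg_bounded _ _ _ _ _ 1); last exact: indic_bound.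
  exact: measurable_indic.
have key : La * fine (P (A m `&` C m)) + \int[P]_w (\1_(N m.+1) w * S m.+1 w)
    <= \int[P]_w (\1_(A m) w * S m.+1 w).
  rewrite -Rint_P// -RintegralZl//; last first.
    apply: (@intg_bounded _ _ _ _ _ 1); last exact: indic_bound.
    exact: measurable_indic.
  rewrite -(RintegralD measurableT iH iN); apply: le_Rint => //; first exact: intgD.
  move=> w; have [Aw|Aw] := pselect (A m w); last first.
    have Nw : ~ N m.+1 w by rewrite NE => -[].
    have Iw : ~ (A m `&` C m) w by case.
    by rewrite (indic0 Aw) (indic0 Nw) (indic0 Iw) mulr0 !mul0r addr0.
  rewrite (indic1 Aw) mul1r; have [Cw|Cw] := pselect (C m w).
    have Nw : ~ N m.+1 w by rewrite NE => -[].
    have Iw : (A m `&` C m) w by [].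
    by rewrite (indic0 Nw) (indic1 Iw) mulr1 mul0r addr0 SC.
  have Nw : N m.+1 w by rewrite NE.
  have Iw : ~ (A m `&` C m) w by case.
  by rewrite (indic1 Nw) (indic0 Iw) mulr0 mul1r add0r.
have sub : fine (P (\bigcup_(k in `I_m.+1) (A k `&` C k))) <=
    fine (P (\bigcup_(k in `I_m) (A k `&` C k))) + fine (P (A m `&` C m)).
  rewrite -fineD ?fin_num_measure// fine_le ?fin_numD ?fin_num_measure//.
  apply: (@le_trans _ _ (P ((\bigcup_(k in `I_m) (A k `&` C k)) `|` (A m `&` C m)))).
    apply: le_measure; rewrite ?inE//; first exact: measurableU.
    move=> w [k/=]; rewrite ltnS leq_eqVlt => /orP[/eqP ->|km] h; first by right.
    by left; exists k.
  exact: measureU2.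
have := ler_wpM2l La0 sub.
rewrite -natr1 mulrDl mul1r; lra.
Qed.

(** Fatou's lemma for sets: the tail intersections increase to the limit inferior, and each lies in
    some [A n] with [n1 <= n]. It serves because a path enters the events only from a rank that
    depends on the path. *)
Lemma liminf_set_bound (A : nat -> set T) (La K : R) (n1 : nat) : 0 <= La ->
  (forall n, measurable (A n)) ->
  (forall n, (n1 <= n)%N -> La * fine (P (A n)) <= K) ->
  La * fine (P (\bigcup_m \bigcap_(n in [set n | (m <= n)%N]) A n)) <= K.
Proof.
move=> La0 mA AK.
set B := fun m => \bigcap_(n in [set n | (m <= n)%N]) A n.
have mB m : measurable (B m) by exact: bigcap_measurableType.
have BK m : La * fine (P (B m)) <= K.
  have := AK (maxn n1 m) (leq_maxl _ _); apply: le_trans.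
  rewrite ler_wpM2l// fine_P_le// => w; apply.
  by rewrite /= leq_maxr.
have cvg : (fun m => P (B m)) @ \oo --> P (\bigcup_m B m).
  apply: nondecreasing_cvg_mu => //; first exact: bigcup_measurable.
  move=> m n mn; apply/subsetPset => w Bw k/= nk; apply: Bw.
  exact: leq_trans mn nk.
have cvg' : (fun m => fine (P (B m))) @ \oo --> fine (P (\bigcup_m B m)).
  apply: fine_cvg; rewrite fineK ?fin_num_measure//.
  exact: bigcup_measurable.
have c2 : (fun m => La * fine (P (B m))) @ \oo --> La * fine (P (\bigcup_m B m)).
  exact: cvgMr.
rewrite -(cvg_lim _ c2)//; apply: limr_le; first by apply/cvg_ex; eexists; exact: c2.
by near=> m; exact: BK.
Unshelve. all: by end_near. Qed.

End HittingBound.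

(** * Lyapunov functions and admissible paths *)

Section Lyapunov.
Context {R : realType}.
Implicit Types (Phi : R -> R -> R) (t T N ka : R).

(** Quantifying over all measurable types lets the same fact be used for the ambient sigma-algebra
    and for each [F t]. *)
Definition meas2 (f : R -> R -> R) :=
  forall (d : measure_display) (T : measurableType d) (x y : T -> R),
    measurable_fun setT x -> measurable_fun setT y ->
    measurable_fun setT (fun w => f (x w) (y w)).

Definition bad (k2 x y : R) : R := ((x < k2) || (y < k2))%:R.

Lemma bad_bounds k2 x y : 0 <= bad k2 x y <= 1.
Proof. by rewrite /bad ler0n lern1 leq_b1. Qed.

Lemma meas2_bad k2 : meas2 (bad k2).
Proof.
move=> d T x y mx my.
rewrite (_ : (fun w => _) = \1_([set w | x w < k2] `|` [set w | y w < k2])).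
  apply: measurable_indic; apply: measurableU; rewrite -[X in measurable X]setTI.
  - have := mx measurableT `]-oo, k2[%classic (measurable_itv _).
    by congr measurable; apply/seteqP; split => w /=; rewrite in_itv.
  - have := my measurableT `]-oo, k2[%classic (measurable_itv _).
    by congr measurable; apply/seteqP; split => w /=; rewrite in_itv.
apply/funext => w; rewrite /bad indicE; congr (nat_of_bool _)%:R.
by apply/idP/idP => [/orP h|]; [rewrite inE|rewrite inE => -[h|h]; rewrite h ?orbT].
Qed.

(* One grid step of length [h], with Brownian increments [b], [c] and
   [I], [J] the increments of the integrals of [1/X], [1/Y], multiplies
   [Phi + ka] by at least [1 + D]; the drift condition then makes
   [- ln (Phi + ka)] a supermartingale up to [th], except when one coordinate
   is below [k2]. *)
Definition step_data (al be ga de rho : R) Phi (N ka C k2 K th r : R)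
    (p q s m : R -> R -> R) :=
  [/\ meas2 p, meas2 q, meas2 s & meas2 m] /\
  forall x y : R, 0 <= x <= N -> 0 <= y <= N ->
  [/\ [/\ `|p x y| <= K, `|q x y| <= K, `|s x y| <= K & `|m x y| <= K],
      - (2 * s x y + m x y)
        + 1 / 2 * (p x y ^+ 2 + q x y ^+ 2 + 2 * rho * p x y * q x y)
      <= C * bad k2 x y + th &
      forall x' y' b c h I J : R, 0 <= x' -> 0 <= y' -> `|b| <= r -> `|c| <= r ->
        0 <= h -> h / (x + r) <= I -> h / (y + r) <= J ->
        x' = x + b + al * I + be * J -> y' = y + c + ga * I + de * J ->
        (Phi x y + ka) * (1 + (p x y * b + q x y * c
          + s x y * (b ^+ 2 + c ^+ 2) + m x y * h)) <= Phi x' y' + ka].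

(** The quantifiers of [ly_step] encode the order of choice: [C] precedes [k2], so that the budget
    [C * eps] can be fixed before the level; [K] precedes [th], and the radius comes last, so that
    [r] may be shrunk in terms of [th] and [K]. *)
Record lyapunov (al be ga de rho : R) Phi : Prop := Lyapunov {
  ly_ge0 : forall x y : R, 0 <= x -> 0 <= y -> 0 <= Phi x y ;
  ly_gt0 : forall x y : R, 0 < x -> 0 < y -> 0 < Phi x y ;
  ly_meas : meas2 Phi ;
  ly_bound : forall N : R, exists M : R,
    forall x y : R, 0 <= x <= N -> 0 <= y <= N -> Phi x y <= M ;
  ly_small : forall ka : R, 0 < ka -> exists2 e : R, 0 < e &
    forall x y : R, 0 <= x <= e -> 0 <= y <= e -> Phi x y <= ka ;
  ly_step : forall N ka : R, 0 <= N -> 0 < ka -> exists2 C : R, 0 <= C &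
    forall k2 : R, 0 < k2 -> exists K : R, forall th : R, 0 < th <= 1 ->
    exists2 r0 : R, 0 < r0 & forall r : R, 0 < r <= r0 -> exists p q s m,
      step_data al be ga de rho Phi N ka C k2 K th r p q s m }.

(* [x], [y], [b], [c] are the paths of [X], [Y], [B], [C], and [I], [J] those of
   the integrals of [1/X], [1/Y].  Bounds are required at rational times only, so
   that they define events of the filtration. *)
Record path_ok (al be ga de : R) (x y b c I J : R -> R) : Prop := PathOk {
  po_ge0 : forall t : R, 0 <= t -> 0 <= x t /\ 0 <= y t ;
  po_x : forall s t : R, 0 <= s -> s <= t ->
    x t = x s + (b t - b s) + al * (I t - I s) + be * (J t - J s) ;
  po_y : forall s t : R, 0 <= s -> s <= t ->
    y t = y s + (c t - c s) + ga * (I t - I s) + de * (J t - J s) ;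
  po_I : forall s t m : R, 0 <= s -> s < t -> 0 < m ->
    (forall u : rat, s <= ratr u <= t -> x (ratr u) <= m) -> (t - s) / m <= I t - I s ;
  po_J : forall s t m : R, 0 <= s -> s < t -> 0 < m ->
    (forall u : rat, s <= ratr u <= t -> y (ratr u) <= m) -> (t - s) / m <= J t - J s ;
  po_Imono : forall s t : R, 0 <= s -> s <= t -> I s <= I t ;
  po_Jmono : forall s t : R, 0 <= s -> s <= t -> J s <= J t ;
  po_unif : forall T e : R, 0 < e -> exists2 dl : R, 0 < dl &
    forall s t : R, 0 <= s <= T -> 0 <= t <= T -> `|s - t| < dl ->
    [/\ `|x s - x t| <= e, `|y s - y t| <= e, `|b s - b t| <= e & `|c s - c t| <= e] ;
  po_bound : forall T, exists M : R, forall t : R, 0 <= t <= T -> x t <= M /\ y t <= M ;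
  po_pos : forall t : R, 0 < t -> exists2 u : rat, 0 < (ratr u : R) < t &
    0 < x (ratr u) /\ 0 < y (ratr u) }.

Definition good_path (al be ga de : R) (x y b c : R -> R) :=
  exists I J, path_ok al be ga de x y b c I J.

End Lyapunov.

(** Needed to take logarithms of the multiplicative inequality of [step_data] and to split the
    product. *)
Lemma log_step_gt0 (R : realType) (K th p q s m b c h : R) : 1 <= K -> 0 < th <= 1 ->
  `|p| <= K -> `|q| <= K -> `|s| <= K -> `|m| <= K ->
  `|b| <= th / (60 * K ^+ 3) -> `|c| <= th / (60 * K ^+ 3) ->
  0 <= h <= th / (60 * K ^+ 3) ->
  0 < 1 + (p * b + q * c + s * (b ^+ 2 + c ^+ 2) + m * h).
Proof.
move=> K1 /andP[th0 th1] pK qK sK mK.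
set r := th / _ => br cr /andP[h0 hr].
have K0 : 0 < K by lra.
have r0 : 0 <= r by exact: le_trans (normr_ge0 b) br.
have K3r : 60 * (K ^+ 3 * r) = th.
  by rewrite /r; field; rewrite gt_eqF.
have K2 : K <= K ^+ 2 by rewrite expr2 ler_peMr//; lra.
have K23 : K ^+ 2 <= K ^+ 3 by rewrite [leRHS]exprS ler_peMl ?sqr_ge0.
have Kr : 60 * (K * r) <= 1.
  rewrite (le_trans _ th1)// -K3r ler_pM2l// ler_wpM2r//; lra.
have r1 : r <= 1.
  by have : 1 * r <= K * r by [rewrite ler_wpM2r]; lra.
have b2r : b ^+ 2 <= r.
  by rewrite -real_normK ?num_real// expr2 -[leRHS]mulr1 ler_pM//; lra.
have c2r : c ^+ 2 <= r.
  by rewrite -real_normK ?num_real// expr2 -[leRHS]mulr1 ler_pM//; lra.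
have lb u x y : `|u| <= K -> `|x| <= y -> - (K * y) <= u * x.
  move=> uK xy; rewrite lerNl -mulNr (le_trans (ler_norm _))// normrM normrN.
  by rewrite ler_pM.
have a1 := lb _ _ _ pK br; have a2 := lb _ _ _ qK cr.
have a3 := lb _ (b ^+ 2 + c ^+ 2) (2 * r) sK.
have a4 := lb _ h r mK; rewrite (ger0_norm h0) in a4.
rewrite (ger0_norm (addr_ge0 (sqr_ge0 b) (sqr_ge0 c))) in a3.
have {}a3 : - (K * (2 * r)) <= s * (b ^+ 2 + c ^+ 2) by apply: a3; lra.
have {}a4 := a4 hr; lra.
Qed.

(** * The killed process on a time grid *)

Section Grid.
Context {d : measure_display} {Om : measurableType d} {R : realType}.
Variable P : probability Om R.
Variable F : R -> set (set Om).
Variables (al be ga de rho : R) (B C X Y : R -> Om -> R) (Om0 : set Om).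
Variable Phi : R -> R -> R.
Hypothesis fF : filtration F.
Hypothesis rho1 : -1 <= rho.
Hypothesis aB : adapted F B.
Hypothesis aC : adapted F C.
Hypothesis aX : adapted F X.
Hypothesis aY : adapted F Y.
Hypothesis mgf : forall s t, 0 <= s -> s <= t -> forall A, F s A -> forall u1 u2 : R,
   (\int[P]_(w in A) (expR (u1 * (B t w - B s w) + u2 * (C t w - C s w)))%:E
    = P A * (expR ((t - s) / 2 * (u1 ^+ 2 + 2 * rho * u1 * u2 + u2 ^+ 2)))%:E)%E.
Hypothesis FOm0 : F 0 Om0.
Hypothesis goodOm0 : forall w, Om0 w ->
  good_path al be ga de (X ^~ w) (Y ^~ w) (B ^~ w) (C ^~ w).
Hypothesis lyP : lyapunov al be ga de rho Phi.

Lemma filtration_sigma t : 0 <= t -> sigma_algebra setT (F t).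
Proof. by move=> t0; case: fF => /(_ t t0)[]. Qed.

Lemma filtration_measurable t : 0 <= t -> F t `<=` measurable.
Proof. by move=> t0; case: fF => /(_ t t0)[]. Qed.

Lemma filtration_mono s t A : 0 <= s -> s <= t -> F s A -> F t A.
Proof. by move=> s0 st; case: fF => _ h; exact: h. Qed.

Lemma filtration_setE t (A : set Om) : 0 <= t ->
  F t A = measurable (A : set (g_sigma_algebraType (F t))).
Proof. by move=> t0; rewrite (measurable_g_measurableTypeE (filtration_sigma t0)). Qed.

Lemma adapted_gmeas (Z : R -> Om -> R) s t : adapted F Z -> 0 <= s -> s <= t ->
  gmeas (F t) (Z s).
Proof.
move=> aZ s0 st; apply/(gmeasP (filtration_sigma (le_trans s0 st))) => E mE.
by apply: (filtration_mono s0 st); exact: aZ.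
Qed.

Lemma filtration_le t (f g : Om -> R) : 0 <= t -> gmeas (F t) f -> gmeas (F t) g ->
  F t [set w | f w <= g w].
Proof.
move=> t0 mf mg; have mgf_ : gmeas (F t) (fun w => g w - f w) by exact: measurable_funB.
have := gmeas_setge (filtration_sigma t0) 0 mgf_.
by congr (F t); apply/seteqP; split => w /=; rewrite subr_ge0.
Qed.

(* [h * badsum k] is the time spent below [k2] up to [tk k], and [eps] its
   budget. *)
Section Params.
Variables (ka Cc k2 r N eta eps q h : R).

Definition tk (k : nat) : R := q + k%:R * h.

Definition badsum (k : nat) (w : Om) : R :=
  \sum_(i < k) bad k2 (X (tk i) w) (Y (tk i) w).

Definition startset : set Om :=
  Om0 `&` [set w | eta <= Phi (X q w) (Y q w)]
      `&` ([set w | X q w <= N] `&` [set w | Y q w <= N]).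

(** Paths are bounded only from above during the step: this is what bounds the integrals of [1/X]
    and [1/Y] from below. Level and budget are tested with index [k.+1] so that [S k.+1] is still
    between [1] and [K]. *)
Definition stepset (k : nat) : set Om :=
  ([set w | `|B (tk k.+1) w - B (tk k) w| <= r] `&`
   [set w | `|C (tk k.+1) w - C (tk k) w| <= r]) `&`
  ([set w | forall u : rat, tk k <= ratr u <= tk k.+1 -> X (ratr u) w <= X (tk k) w + r] `&`
   [set w | forall u : rat, tk k <= ratr u <= tk k.+1 -> Y (ratr u) w <= Y (tk k) w + r]) `&`
  ([set w | X (tk k.+1) w <= N] `&` [set w | Y (tk k.+1) w <= N]) `&`
  [set w | h * badsum k.+1 w <= eps].

Definition hitset (k : nat) : set Om :=
  [set w | Phi (X (tk k.+1) w) (Y (tk k.+1) w) <= ka].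

Fixpoint alive (k : nat) : set Om :=
  if k is k'.+1 then (alive k' `&` stepset k') `\` hitset k' else startset.

Definition Hit (n : nat) : set Om :=
  \bigcup_(k in `I_n) (alive k `&` stepset k `&` hitset k).

Hypothesis q0 : 0 <= q.
Hypothesis h0 : 0 < h.

Lemma tk_ge0 k : 0 <= tk k.
Proof. by rewrite addr_ge0// mulr_ge0// ltW. Qed.

Lemma tkS k : tk k.+1 = tk k + h.
Proof. by rewrite /tk -natr1; ring. Qed.

Lemma tk_le i j : (i <= j)%N -> tk i <= tk j.
Proof. by move=> ij; rewrite lerD2l ler_pM2r// ler_nat. Qed.

(** Left endpoints are counted, so [badsum k.+1] is already known at time [tk k]. *)
Lemma badsum_gmeas k j : (k <= j.+1)%N -> gmeas (F (tk j)) (badsum k).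
Proof.
move=> kj; apply: measurable_sum => i.
have ij : tk i <= tk j by apply: tk_le; rewrite -ltnS (leq_trans _ kj).
by apply: meas2_bad; apply: (adapted_gmeas _ (tk_ge0 i) ij).
Qed.

Lemma Phi_gmeas i j : (i <= j)%N -> gmeas (F (tk j)) (fun w => Phi (X (tk i) w) (Y (tk i) w)).
Proof.
move=> ij; apply: (ly_meas lyP); exact: (adapted_gmeas _ (tk_ge0 i) (tk_le ij)).
Qed.

Lemma F_hitset k : F (tk k.+1) (hitset k).
Proof.
apply: filtration_le; first exact: tk_ge0.
- exact: Phi_gmeas.
- exact: measurable_cst.
Qed.

Lemma F_ratset (Z : R -> Om -> R) k : adapted F Z ->
  F (tk k.+1) [set w | forall u : rat, tk k <= ratr u <= tk k.+1 ->
    Z (ratr u) w <= Z (tk k) w + r].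
Proof.
move=> aZ; set A := [set w | _].
pose D (u : rat) := [set w | tk k <= ratr u <= tk k.+1 -> Z (ratr u) w <= Z (tk k) w + r].
have -> : A = ~` \bigcup_u ~` D u.
  rewrite setC_bigcup; apply/seteqP; split => w.
    by move=> Aw u _; rewrite setCK; exact: Aw.
  by move=> Dw u; have := Dw u I; rewrite setCK; apply.
rewrite filtration_setE ?tk_ge0//; apply: measurableC.
apply: bigcupT_measurable_rat => u; apply: measurableC.
have [/andP[h1 h2]|nu] := boolP (tk k <= ratr u <= tk k.+1); last first.
  rewrite (_ : D u = setT); first exact: measurableT.
  by apply/seteqP; split => // w _; rewrite /D/= (negbTE nu).
have -> : D u = [set w | Z (ratr u) w <= Z (tk k) w + r].
  by apply/seteqP; split => w; rewrite /D/= h1 h2/=; [apply|].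
rewrite -filtration_setE ?tk_ge0//; apply: filtration_le; first exact: tk_ge0.
- by apply: adapted_gmeas => //; exact: le_trans (tk_ge0 k) h1.
- apply: measurable_funD; last exact: measurable_cst.
  by apply: adapted_gmeas => //; [exact: tk_ge0|exact: tk_le].
Qed.

Lemma F_stepset k : F (tk k.+1) (stepset k).
Proof.
have t0 := tk_ge0 k.+1.
have FI A1 A2 : F (tk k.+1) A1 -> F (tk k.+1) A2 -> F (tk k.+1) (A1 `&` A2).
  by rewrite !filtration_setE//; exact: measurableI.
have gZ (Z : R -> Om -> R) : adapted F Z -> gmeas (F (tk k.+1)) (Z (tk k)).
  by move=> aZ; apply: adapted_gmeas => //; [exact: tk_ge0|exact: tk_le].
have gZ' (Z : R -> Om -> R) : adapted F Z -> gmeas (F (tk k.+1)) (Z (tk k.+1)).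
  by move=> aZ; apply: adapted_gmeas.
have gcst (c : R) : gmeas (F (tk k.+1)) (fun=> c) by exact: measurable_cst.
have gabs (Z : R -> Om -> R) : adapted F Z ->
    F (tk k.+1) [set w | `|Z (tk k.+1) w - Z (tk k) w| <= r].
  move=> aZ; apply: filtration_le => //.
  apply: measurableT_comp; first exact: normr_measurable.
  by apply: measurable_funB; [exact: gZ'|exact: gZ].
apply: (FI); first apply: (FI); first apply: (FI).
- by apply: (FI); exact: gabs.
- by apply: (FI); exact: F_ratset.
- by apply: (FI); apply: filtration_le => //; exact: gZ'.
- apply: filtration_le => //; apply: measurable_funM => //.
  exact: badsum_gmeas.
Qed.

Lemma F_alive k : F (tk k) (alive k).
Proof.
elim: k => [|k IH].
  have q00 : tk 0 = q by rewrite /tk mul0r addr0.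
  have t0 : 0 <= tk 0 by rewrite q00.
  have FI A1 A2 : F (tk 0) A1 -> F (tk 0) A2 -> F (tk 0) (A1 `&` A2).
    by rewrite !filtration_setE//; exact: measurableI.
  have gX : gmeas (F (tk 0)) (X q) by apply: adapted_gmeas => //; rewrite q00.
  have gY : gmeas (F (tk 0)) (Y q) by apply: adapted_gmeas => //; rewrite q00.
  have gcst (c : R) : gmeas (F (tk 0)) (fun=> c) by exact: measurable_cst.
  rewrite /= /startset; apply: (FI); first apply: (FI).
  - exact: (filtration_mono (lexx 0) t0 FOm0).
  - by apply: filtration_le => //; apply: (ly_meas lyP).
  - by apply: (FI); apply: filtration_le.
rewrite /=.
have {}IH : F (tk k.+1) (alive k).
  by apply: filtration_mono IH; [exact: tk_ge0|exact: tk_le].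
have := F_stepset k; have := F_hitset k; move: IH.
rewrite !filtration_setE ?tk_ge0// => h1 h2 h3.
by apply: measurableD => //; exact: measurableI.
Qed.

Lemma alive_inv k w : alive k w ->
  [/\ Om0 w, X (tk k) w <= N, Y (tk k) w <= N & (0 <= eps -> h * badsum k w <= eps)].
Proof.
elim: k => [|k IH].
  rewrite /= /startset /tk mul0r addr0 => -[[? _] [? ?]]; split=> //.
  by rewrite /badsum big_ord0 mulr0.
by move=> [[/IH[? _ _ _] [[[_ _] [? ?]] ?]] _].
Qed.

Lemma Hit_measurable n : measurable (Hit n).
Proof.
apply: bigcup_measurable => k _; apply: (filtration_measurable (tk_ge0 k.+1)).
have : F (tk k.+1) (alive k).
  by apply: filtration_mono (F_alive k); [exact: tk_ge0|exact: tk_le].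
have := F_stepset k; have := F_hitset k.
rewrite !filtration_setE ?tk_ge0// => h1 h2 h3.
by do 2 apply: measurableI => //.
Qed.

(** The process is [S k = L - ln (Phi + ka) + Cc * (eps - h * badsum k)]. The last term falls by
    [Cc * bad * h] at each step, which pays for the drift excess of [step_data];
    [L = 1 + ln (M + 1)] makes [S] at least [1]. On a hit [Phi + ka <= 2 * ka], hence the factor on
    the left; at the start [Phi >= eta]. *)
Lemma grid_bound (M K th : R) (p qq s m : R -> R -> R) (n : nat) :
  0 < ka <= 1 -> 0 <= Cc -> 0 < eps -> 0 < eta <= 1 -> 0 <= M ->
  (forall x y, 0 <= x <= N -> 0 <= y <= N -> Phi x y <= M) ->
  step_data al be ga de rho Phi N ka Cc k2 K th r p qq s m ->
  1 <= K -> Cc <= K -> 1 + ln (M + 1) - ln ka + Cc * eps <= K ->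
  0 < th <= 1 -> 0 < r <= th / (60 * K ^+ 3) -> h <= th / (48 * (100 * K ^+ 4)) ->
  0 <= 1 + ln (M + 1) - ln (2 * ka) ->
  (1 + ln (M + 1) - ln (2 * ka)) * fine (P (Hit n)) <=
    1 + ln (M + 1) - ln eta + Cc * eps + n%:R * (5 * th * h).
Proof.
move=> /andP[ka0 ka1] Cc0 eps0 /andP[eta0 eta1] M0 PhiM [[mp mq ms mm] sd] K1 CK LK th01.
move=> /andP[r0 rK] hK La0; have [h0' q0' rho1'] := And3 h0 q0 rho1.
have hr : 0 <= h <= th / (60 * K ^+ 3).
  rewrite ltW//= (le_trans hK)// ler_pM2l; last by case/andP: th01.
  have K0 : 0 < K by lra.
  have K3 : 0 < K ^+ 3 by rewrite exprn_gt0.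
  have K34 : K ^+ 3 <= K ^+ 4 by rewrite [leRHS]exprS ler_peMl ?exprn_ge0// ltW.
  by rewrite lef_pV2 ?posrE ?mulr_gt0 ?exprn_gt0//; lra.
set L := 1 + ln (M + 1).
pose S k w := L - ln (Phi (X (tk k) w) (Y (tk k) w) + ka)
  + Cc * (eps - h * badsum k w).
have XY0 k w : Om0 w -> 0 <= X (tk k) w /\ 0 <= Y (tk k) w.
  by move=> /goodOm0[I [J ok]]; exact: (po_ge0 ok (tk_ge0 k)).
have Phi0 x y : 0 <= x <= N -> 0 <= y <= N -> 0 <= Phi x y.
  by move=> /andP[x0 _] /andP[y0 _]; exact: (ly_ge0 lyP).
have lnPhi x y : 0 <= x <= N -> 0 <= y <= N ->
    ln ka <= ln (Phi x y + ka) <= ln (M + 1).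
  move=> xN yN; have a := Phi0 _ _ xN yN; have b := PhiM _ _ xN yN.
  by rewrite !ler_ln ?posrE; try (apply/andP; split); lra.
have bs0 k w : 0 <= badsum k w.
  by apply: sumr_ge0 => i _; case/andP: (bad_bounds k2 (X (tk i) w) (Y (tk i) w)).
have range k w : Om0 w -> X (tk k) w <= N -> Y (tk k) w <= N ->
    0 <= X (tk k) w <= N /\ 0 <= Y (tk k) w <= N.
  by move=> w0 -> ->; have [-> ->] := XY0 k w w0.
have SK k w : Om0 w -> X (tk k) w <= N -> Y (tk k) w <= N ->
    h * badsum k w <= eps -> 1 <= S k w <= K.
  move=> w0 xN yN bw; have [xx yy] := range k w w0 xN yN.
  have /andP[l1 l2] := lnPhi _ _ xx yy.
  have e1 : 0 <= Cc * (eps - h * badsum k w) by rewrite mulr_ge0// subr_ge0.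
  have e2 : Cc * (eps - h * badsum k w) <= Cc * eps.
    by rewrite ler_wpM2l// gerBl mulr_ge0// ltW.
  by rewrite /S /L; apply/andP; split; lra.
have SKa k w : alive k w -> 1 <= S k w <= K.
  by move=> /alive_inv[w0 xN yN /(_ (ltW eps0)) bw]; exact: SK.
have SKs k w : (alive k `&` stepset k) w -> 1 <= S k.+1 w <= K.
  by move=> [/alive_inv[w0 _ _ _] [[_ [xN yN]] bw]]; exact: SK.
have gS k : gmeas (F (tk k)) (S k).
  apply: measurable_funD.
    apply: measurable_funB; first exact: measurable_cst.
    apply: measurableT_comp; first exact: measurable_ln.
    by apply: measurable_funD; [exact: Phi_gmeas|exact: measurable_cst].
  apply: measurable_funM; first exact: measurable_cst.
  apply: measurable_funB; first exact: measurable_cst.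
  by apply: measurable_funM; [exact: measurable_cst|exact: badsum_gmeas].
have mS k : measurable_fun setT (S k).
  exact: (gmeas_measurable (filtration_sigma (tk_ge0 k)) (filtration_measurable (tk_ge0 k)) (gS k)).
have Fa k : measurable (alive k) by apply: (filtration_measurable (tk_ge0 k)); exact: F_alive.
have Fs k : measurable (stepset k).
  by apply: (filtration_measurable (tk_ge0 k.+1)); exact: F_stepset.
have Fh k : measurable (hitset k) by apply: (filtration_measurable (tk_ge0 k.+1)); exact: F_hitset.
have i0 : intg P (fun w => \1_(alive 0) w * S 0 w).
  apply: (@intg_bounded _ _ _ _ _ K).
    by apply: measurable_funM => //; exact: measurable_indic.
  move=> w; have [aw|aw] := pselect (alive 0 w); last by rewrite indic0// mul0r normr0; lra.
  by rewrite indic1// mul1r; have /andP[a1 a2] := SKa 0 w aw; rewrite ger0_norm//; lra.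
have := @hitting_bound _ _ _ P alive (fun k => alive k `&` stepset k) hitset S
  (L - ln (2 * ka)) (5 * th * h) n La0.
move=> /(_ _ Fh _ (Fa 0) _ _ _ i0 _) hb.
apply: (@le_trans _ _ (\int[P]_w (\1_(alive 0) w * S 0 w) + n%:R * (5 * th * h))).
  apply: hb => //.
  - by move=> k; exact: measurableI.
  - by move=> k w /SKs/andP[]; lra.
  - move=> k w aw; rewrite /hitset/= => hw.
    have [/alive_inv[w0 _ _ _] [[_ [xN yN]] bw]] := aw.
    have [xx yy] := range k.+1 w w0 xN yN; have P0 := Phi0 _ _ xx yy.
    have e1 : 0 <= Cc * (eps - h * badsum k.+1 w) by rewrite mulr_ge0// subr_ge0.
    have : ln (Phi (X (tk k.+1) w) (Y (tk k.+1) w) + ka) <= ln (2 * ka).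
      by rewrite ler_ln ?posrE; lra.
    by rewrite /S; lra.
  - by move=> k w /SKa/andP[]; lra.
  - move=> k _.
    have t0 := tk_ge0 k; have sG := filtration_sigma t0; have Gm := filtration_measurable t0.
    have kS : tk k <= tk k.+1 by exact: tk_le.
    have gX : gmeas (F (tk k)) (X (tk k)) by exact: adapted_gmeas.
    have gY : gmeas (F (tk k)) (Y (tk k)) by exact: adapted_gmeas.
    have mZ (Z : R -> Om -> R) j : adapted F Z -> measurable_fun setT (Z (tk j)).
      move=> aZ; apply: (gmeas_measurable (filtration_sigma (tk_ge0 j))
        (filtration_measurable (tk_ge0 j))).
      by apply: adapted_gmeas => //; exact: tk_ge0.
    apply: (@one_step _ _ _ P (F (tk k)) sG Gm
      (fun w => B (tk k.+1) w - B (tk k) w) (fun w => C (tk k.+1) w - C (tk k) w)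
      rho h (alive k) (alive k `&` stepset k) (S k) (S k.+1)
      (fun w => p (X (tk k) w) (Y (tk k) w)) (fun w => qq (X (tk k) w) (Y (tk k) w))
      (fun w => s (X (tk k) w) (Y (tk k) w)) (fun w => m (X (tk k) w) (Y (tk k) w))
      (fun w => Cc * bad k2 (X (tk k) w) (Y (tk k) w)) K th) => //.
    + by apply: measurable_funB; exact: mZ.
    + by apply: measurable_funB; exact: mZ.
    + move=> A FA u1 u2; have := mgf t0 kS FA u1 u2.
      by rewrite tkS [tk k + h]addrC addrK.
    + exact: F_alive.
    + exact: measurableI.
    + exact: mp.
    + exact: mq.
    + exact: ms.
    + exact: mm.
    + by apply: measurable_funM; [exact: measurable_cst|exact: meas2_bad].
    + by rewrite ltW.
    + by move=> w; exact: SKa.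
    + move=> w /alive_inv[w0 xN yN _]; have [xx yy] := range k w w0 xN yN.
      have [[? ? ? ?] _ _] := sd _ _ xx yy; split=> //.
      have /andP[b0 b1] := bad_bounds k2 (X (tk k) w) (Y (tk k) w).
      rewrite ger0_norm ?mulr_ge0//; apply: le_trans CK.
      by rewrite -[leRHS]mulr1 ler_wpM2l.
    + move=> w /alive_inv[w0 xN yN _]; have [xx yy] := range k w w0 xN yN.
      by have [_ dr _] := sd _ _ xx yy; lra.
    + move=> w aw; have /andP[S1 _] := SKs k w aw.
      have [/alive_inv[w0 xN yN _] [[[[bw cw] [ux uy]] _] _]] := aw.
      have [xx yy] := range k w w0 xN yN.
      have bw' := le_trans bw rK; have cw' := le_trans cw rK.
      split=> //; first lra.
      have [[p1 q1 s1 m1] _ st] := sd _ _ xx yy.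
      have [I [J ok]] := goodOm0 w0.
      have xy0 := XY0 k w w0; have xy0' := XY0 k.+1 w w0.
      have tt : tk k < tk k.+1 by rewrite tkS ltrDl.
      have hE : tk k.+1 - tk k = h by rewrite tkS addrC addKr.
      (* On the good step [X] stays below [X (tk k) + r] at rational times, so the integral of [1/X]
         grows by at least [h / (X (tk k) + r)]; likewise for [Y]. *)
      have Ik := @po_I _ _ _ _ _ _ _ _ _ _ _ ok (tk k) (tk k.+1) (X (tk k) w + r) t0 tt _ ux.
      have Jk := @po_J _ _ _ _ _ _ _ _ _ _ _ ok (tk k) (tk k.+1) (Y (tk k) w + r) t0 tt _ uy.
      have {}Ik : h / (X (tk k) w + r) <= I (tk k.+1) - I (tk k).
        by rewrite -hE; apply: Ik; exact: ltr_wpDl xy0.1 r0.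
      have {}Jk : h / (Y (tk k) w + r) <= J (tk k.+1) - J (tk k).
        by rewrite -hE; apply: Jk; exact: ltr_wpDl xy0.2 r0.
      have key := st (X (tk k.+1) w) (Y (tk k.+1) w) _ _ h _ _ xy0'.1 xy0'.2 bw cw (ltW h0)
        Ik Jk (po_x ok t0 kS) (po_y ok t0 kS).
      have pos := log_step_gt0 K1 th01 p1 q1 s1 m1 bw' cw' hr.
      have ph : 0 < Phi (X (tk k) w) (Y (tk k) w) + ka.
        exact: ltr_wpDl (Phi0 _ _ xx yy) ka0.
      have ph' : 0 < Phi (X (tk k.+1) w) (Y (tk k.+1) w) + ka.
        exact: ltr_wpDl (ly_ge0 lyP xy0'.1 xy0'.2) ka0.
      have := key; rewrite -ler_ln ?posrE ?mulr_gt0// lnM ?posrE// => lk.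
      rewrite /S /badsum big_ord_recr/= -/(badsum k w).
      lra.
rewrite lerD2r.
have le0 : 0 <= L - ln eta + Cc * eps.
  have l1 : 0 <= ln (M + 1) by apply: ln_ge0; lra.
  have l2 := ln_le0 eta1; have l3 : 0 <= Cc * eps by rewrite mulr_ge0// ltW.
  by rewrite /L; lra.
rewrite -[leRHS](Rint_cst P); apply: le_Rint => //; first exact: intg_cst.
move=> w; have [aw|aw] := pselect (alive 0 w); last by rewrite indic0// mul0r.
rewrite indic1// mul1r.
have [w0 xN yN _] := alive_inv aw; have [xx yy] := range 0 w w0 xN yN.
have ph : eta <= Phi (X (tk 0) w) (Y (tk 0) w).
  by rewrite /tk mul0r addr0; case: aw => -[].
have : ln eta <= ln (Phi (X (tk 0) w) (Y (tk 0) w) + ka).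
  by rewrite ler_ln ?posrE; lra.
by rewrite /S /badsum big_ord0 mulr0 subr0; lra.
Qed.

End Params.

End Grid.

(** * A path reaching the origin is detected by all fine grids *)

Section Pathwise.
Context {d : measure_display} {Om : measurableType d} {R : realType}.
Variables (al be ga de rho : R) (B C X Y : R -> Om -> R) (Om0 : set Om).
Variable Phi : R -> R -> R.
Hypothesis lyP : lyapunov al be ga de rho Phi.

Lemma grid_cell (q h t : R) (m : nat) : (0 < m)%N -> q <= t <= tk q h m ->
  exists2 j, (j < m)%N & tk q h j <= t <= tk q h j.+1.
Proof.
elim: m => // m IH _ /andP[qt tm].
have [tm'|tm'] := leP t (tk q h m); last by exists m; rewrite ?(ltW tm').
case: m IH tm tm' => [|m] IH tm tm'.
  exists 0%N => //; rewrite tm andbT.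
  by move: tm'; rewrite /tk mul0r addr0.
have [|j jm jt] := IH isT; first by rewrite qt.
by exists j => //; exact: ltnW.
Qed.

(** By uniform continuity every step of a fine grid is good, provided the budget holds: the time
    below [k2] is at most [2 * k2 * V], with [V] the growth of the two integrals over the window.
    The threshold [k0] and the rank [n0] depend on the path. *)
Lemma eventually_Hit (w : Om) (ka N eta eps q T : R) : Om0 w ->
  good_path al be ga de (X ^~ w) (Y ^~ w) (B ^~ w) (C ^~ w) ->
  0 <= q -> 0 < T -> 0 < ka -> 0 < eps ->
  eta <= Phi (X q w) (Y q w) ->
  (forall t, q <= t <= q + T -> X t w <= N /\ Y t w <= N) ->
  (exists2 t, q <= t <= q + T & X t w = 0 /\ Y t w = 0) ->
  exists2 k0, 0 < k0 & forall k2, 0 < k2 <= k0 -> forall r, 0 < r ->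
  exists n0 : nat, forall n, (n0 <= n)%N ->
    Hit B C X Y Om0 Phi ka k2 r N eta eps q (T / n%:R) n w.
Proof.
move=> w0 [I [J ok]] q0 T0 ka0 eps0 etaw wN [t tq [xt yt]].
have qT : q <= q + T by rewrite lerDl ltW.
pose V := (I (q + T) - I q) + (J (q + T) - J q).
have V0 : 0 <= V.
  by rewrite addr_ge0// subr_ge0; [exact: (po_Imono ok)|exact: (po_Jmono ok)].
have V1 : 0 < 2 * V + 1 by lra.
exists (eps / (2 * V + 1)); first by rewrite divr_gt0.
move=> k2 /andP[k20 k2V] r r0.
have kV : 2 * k2 * V <= eps.
  by move: k2V; rewrite ler_pdivlMr//; lra.
have [e1 e10 small] := ly_small lyP ka0.
(* One modulus for three purposes: [r] for the good steps, [k2] so that a coordinate below [k2] at a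
   grid point stays below [2 * k2] over the cell, [e1] so that [Phi <= ka] near the origin. *)
pose e := Num.min r (Num.min k2 e1).
have e0 : 0 < e by rewrite !lt_min r0 k20.
have er : e <= r by rewrite ge_min lexx.
have ek : e <= k2 by rewrite !ge_min lexx orbT.
have ee : e <= e1 by rewrite !ge_min lexx !orbT.
have [dl dl0 unif] := po_unif ok (q + T) e0.
exists (Num.trunc (T / dl)).+1 => n nn.
have n0 : (0 < n)%N by exact: leq_ltn_trans nn.
have n0' : 0 < n%:R :> R by rewrite ltr0n.
set h := T / n%:R.
have h0 : 0 < h by rewrite divr_gt0.
have hdl : h < dl.
  rewrite ltr_pdivrMr// mulrC -ltr_pdivrMr//.
  by apply: (lt_le_trans (truncnS_gt _)); rewrite ler_nat.
have tkn : tk q h n = q + T by rewrite /tk /h mulrC divfK// gt_eqF.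
pose tt := tk q h.
have tk0 k : 0 <= tt k by rewrite /tt /tk addr_ge0// mulr_ge0// ltW.
have tkS_ k : tt k.+1 = tt k + h by rewrite /tt tkS.
have tkT k : (k <= n)%N -> q <= tt k <= q + T.
  move=> kn; rewrite -tkn /tt /tk lerDl mulr_ge0 ?(ltW h0)//=.
  by rewrite lerD2l ler_pM2r// ler_nat.
have near k u : (k < n)%N -> tt k <= u <= tt k.+1 ->
    [/\ `|X u w - X (tt k) w| <= e, `|Y u w - Y (tt k) w| <= e,
        `|B u w - B (tt k) w| <= e & `|C u w - C (tt k) w| <= e].
  move=> kn /andP[ku uk]; have /andP[a1 a2] := tkT k (ltnW kn).
  have /andP[a3 a4] := tkT k.+1 kn.
  apply: unif; [apply/andP; split; lra..|].
  by rewrite ger0_norm; move: uk; rewrite tkS_; lra.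
have near' k u : (k < n)%N -> tt k <= u <= tt k.+1 ->
    [/\ `|X u w - X (tt k.+1) w| <= e & `|Y u w - Y (tt k.+1) w| <= e].
  move=> kn /andP[ku uk]; have /andP[a1 a2] := tkT k (ltnW kn).
  have /andP[a3 a4] := tkT k.+1 kn.
  have [] // := unif u (tt k.+1); [apply/andP; split; lra..|].
  by rewrite distrC ger0_norm; move: uk; rewrite tkS_; lra.
have badk k : (k < n)%N -> h * bad k2 (X (tt k) w) (Y (tt k) w) <=
    2 * k2 * ((I (tt k.+1) - I (tt k)) + (J (tt k.+1) - J (tt k))).
  move=> kn; have kS : tt k <= tt k.+1 by rewrite tkS_ lerDl ltW.
  have I0 : 0 <= I (tt k.+1) - I (tt k) by rewrite subr_ge0; exact: (po_Imono ok).
  have J0 : 0 <= J (tt k.+1) - J (tt k) by rewrite subr_ge0; exact: (po_Jmono ok).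
  have k22 : 0 < 2 * k2 by lra.
  have hE : tt k.+1 - tt k = h by rewrite tkS_ addrC addKr.
  have kS' : tt k < tt k.+1 by rewrite tkS_ ltrDl.
  rewrite /bad; have [xk|xk] := ltP (X (tt k) w) k2.
    rewrite /= mulr1.
    have := @po_I _ _ _ _ _ _ _ _ _ _ _ ok (tt k) (tt k.+1) (2 * k2) (tk0 k) kS' k22.
    rewrite hE ler_pdivrMr// => hh.
    apply: (@le_trans _ _ ((I (tt k.+1) - I (tt k)) * (2 * k2))).
      apply: hh => u ku; have [+ _ _ _] := near k _ kn ku.
      by rewrite ler_norml => /andP[_ ?]; lra.
    by rewrite mulrC ler_pM2l//; lra.
  have [yk|yk] := ltP (Y (tt k) w) k2.
    rewrite /= mulr1.
    have := @po_J _ _ _ _ _ _ _ _ _ _ _ ok (tt k) (tt k.+1) (2 * k2) (tk0 k) kS' k22.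
    rewrite hE ler_pdivrMr// => hh.
    apply: (@le_trans _ _ ((J (tt k.+1) - J (tt k)) * (2 * k2))).
      apply: hh => u ku; have [_ + _ _] := near k _ kn ku.
      by rewrite ler_norml => /andP[_ ?]; lra.
    by rewrite mulrC ler_pM2l//; lra.
  by rewrite /= mulr0; apply: mulr_ge0; lra.
have tt0 : tt 0%N = q by rewrite /tt /tk mul0r addr0.
have badS k : (k <= n)%N -> h * badsum X Y k2 q h k w <=
    2 * k2 * ((I (tt k) - I q) + (J (tt k) - J q)).
  elim: k => [|k IH] kn.
    by rewrite /badsum big_ord0 mulr0 tt0 !subrr addr0 mulr0.
  rewrite /badsum big_ord_recr/= mulrDr -/(badsum X Y k2 q h k w).
  by have := IH (ltnW kn); have := badk k kn; rewrite /tt; lra.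
have step k : (k < n)%N -> stepset B C X Y k2 r N eps q h k w.
  move=> kn; have /andP[a1 a2] := tkT k (ltnW kn); have kT := tkT k.+1 kn.
  have kS : tt k <= tt k.+1 by rewrite tkS_ lerDl ltW.
  have [|_ _ nb nc] := near k (tt k.+1) kn; first by rewrite kS lexx.
  have [xN yN] := wN _ kT.
  split; first split; first split; first split.
  - exact: le_trans nb er.
  - exact: le_trans nc er.
  - split=> u ku.
      have [+ _ _ _] := near k _ kn ku.
      by rewrite ler_norml => /andP[_ ?]; rewrite -/tt; lra.
    have [_ + _ _] := near k _ kn ku.
    by rewrite ler_norml => /andP[_ ?]; rewrite -/tt; lra.
  - by [].
  - apply: (le_trans (badS k.+1 kn)); apply: le_trans kV.
    rewrite ler_pM2l; last lra.
    have /andP[_ kT2] := kT.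
    have := @po_Imono _ _ _ _ _ _ _ _ _ _ _ ok _ _ (tk0 k.+1) kT2.
    have := @po_Jmono _ _ _ _ _ _ _ _ _ _ _ ok _ _ (tk0 k.+1) kT2.
    by rewrite /V; lra.
pose Al := alive B C X Y Om0 Phi ka k2 r N eta eps q h.
have main k : (k <= n)%N -> Hit B C X Y Om0 Phi ka k2 r N eta eps q h k w \/ Al k w.
  elim: k => [_|k IH kn].
    right; split; first by [].
    by apply: wN; rewrite lexx.
  have [[i ik hi]|ak] := IH (ltnW kn).
    by left; exists i => //=; exact: ltnW.
  have sk := step k kn.
  have [hk|hk] := pselect (hitset X Y Phi ka q h k w).
    by left; exists k => //=.
  by right.
(* [hitset] looks at the right end of a cell, so the hit is read at [tk j.+1], where both
   coordinates are at most [e]; being alive at [j.+1] is then impossible. *)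
have [|j jn jt] := @grid_cell q h t n n0; first by rewrite tkn.
have [[i ij hi]|] := main j.+1 jn; first by exists i => //=; exact: leq_trans ij jn.
move=> [_]; case; rewrite /hitset/=.
have [nx ny] := near' j t jn jt; rewrite xt yt !sub0r !normrN in nx ny.
have [x0 y0] := po_ge0 ok (tk0 j.+1).
apply: small; apply/andP; split=> //.
  by apply: le_trans ee; rewrite (le_trans (ler_norm _)).
by apply: le_trans ee; rewrite (le_trans (ler_norm _)).
Qed.

End Pathwise.

(** * Almost every path is admissible *)

Section PathRegularity.
Context {R : realType}.
Implicit Types (f x y b c : R -> R) (s t T e : R).
Local Notation mu := (@lebesgue_measure R).

Lemma within_unif f T e : {within [set s | 0 <= s], continuous f} -> 0 < e ->
  exists2 dl, 0 < dl & forall s t, 0 <= s <= T -> 0 <= t <= T ->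
    `|s - t| < dl -> `|f s - f t| <= e.
Proof.
move=> /subspace_continuousP cf e0.
have /compact_near_coveringP nc := @segment_compact R 0 T.
pose Pr (dl : R) (s : R) := 0 <= s -> forall t, 0 <= t -> `|s - t| < dl -> `|f s - f t| <= e.
have := nc R (0 : R)^'+ Pr _ _.
have h : forall s, `[0%R, T]%classic s ->
    \forall s' \near s & dl \near (0 : R)^'+, Pr dl s'.
  move=> s; rewrite /= in_itv/= => /andP[s0 _].
  have e20 : 0 < e / 2 by rewrite divr_gt0.
  have /cvgrPdist_lt /(_ _ e20) := cf s s0.
  move=> /nbhs_ballP[d0 /= d00 hb].
  have d20 : 0 < d0 / 2 by rewrite divr_gt0.
  exists ([set s' | `|s - s'| < d0 / 2], [set dl | dl < d0 / 2]).
    split=> /=; first by apply/nbhs_ballP; exists (d0 / 2).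
    exact: nbhs_right_lt.
  move=> [s' dl] /= [ss' dld] s'0 t t0 s't.
  have h1 : `|f s - f s'| < e / 2 by apply: hb => //=; rewrite /ball/=; lra.
  have h2 : `|f s - f t| < e / 2.
    apply: hb => //=; rewrite /ball/= (le_lt_trans (ler_distD s' _ _))//; lra.
  by rewrite (le_trans (ler_distD (f s) _ _))// [`|f s' - _|]distrC; lra.
move=> /(_ _ h) nr.
have [dl [dl0 hdl]] : exists dl, 0 < dl /\ `[0%R, T]%classic `<=` Pr dl.
  near (0 : R)^'+ => dl; exists dl; split; near: dl => //.
  exact: nbhs_right_gt.
exists dl => // s t /andP[s0 sT] /andP[t0 _] st.
by apply: (hdl s) => //=; rewrite in_itv/= s0.
Unshelve. all: by end_near. Qed.

Lemma within_bounded f T : {within [set s | 0 <= s], continuous f} ->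
  exists M, forall t, 0 <= t <= T -> f t <= M.
Proof.
move=> cf; have [T0|T0] := leP 0 T; last first.
  by exists 0 => t /andP[t0 tT]; have := lt_le_trans T0 t0; rewrite ltNge tT.
have [|c _ hc] := @EVT_max R f 0 T T0.
  apply: continuous_subspaceW cf => s /=; by rewrite in_itv/= => /andP[].
by exists (f c) => t tT; apply: hc; rewrite in_itv.
Qed.

(** The inverse is discontinuous at [0]; on each open half-line it is expressed through [expR] and
    [ln], with the conventional value [0] at [0]. *)
Lemma measurable_invR : measurable_fun setT (fun u : R => u^-1).
Proof.
rewrite (_ : (fun u => _) = (fun u : R => if 0 < u then expR (- ln u) else
    if u < 0 then - expR (- ln (- u)) else 0)); last first.
  apply/funext => u; case: (ltgtP 0 u) => u0.
  - by rewrite expRN lnK.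
  - by rewrite expRN lnK ?posrE ?oppr_gt0// invrN opprK.
  - by rewrite -u0 invr0.
apply: measurable_fun_ifT.
- exact: measurable_fun_ltr.
- apply: measurableT_comp; first exact: measurable_expR.
  exact: measurable_funN.
- apply: measurable_fun_ifT.
  + exact: measurable_fun_ltr.
  + apply: measurable_funN; apply: measurableT_comp; first exact: measurable_expR.
    apply: measurable_funN; apply: measurableT_comp; first exact: measurable_ln.
    exact: measurable_funN.
  + exact: measurable_cst.
Qed.

Lemma within_rat_le f s t m : {within [set s | 0 <= s], continuous f} -> 0 <= s ->
  (forall u : rat, s <= ratr u <= t -> f (ratr u) <= m) ->
  forall u, s < u < t -> f u <= m.
Proof.
move=> cf s0 fm u /andP[su ut]; rewrite leNgt; apply/negP => mu_.
have e0 : 0 < (f u - m) / 2 by rewrite divr_gt0// subr_gt0.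
have [dl dl0 hdl] := @within_unif f t _ cf e0.
have lt1 : u < Num.min t (u + dl) by rewrite lt_min ut/= ltrDl.
have [v] := rat_in_itvoo lt1.
rewrite in_itv/= lt_min => /andP[uv /andP[vt vdl]].
have fv : f (ratr v) <= m by apply: fm; apply/andP; split; lra.
have := hdl u (ratr v); rewrite ler_norml => h.
have {h}/andP[_ h] : - ((f u - m) / 2) <= f u - f (ratr v) <= (f u - m) / 2.
  by apply: h; [apply/andP; split; lra..|rewrite distrC ger0_norm; lra].
lra.
Qed.

Section InverseIntegral.
Variable x : R -> R.
Hypothesis x0 : forall t, 0 <= t -> 0 <= x t.
Hypothesis cx : {within [set s | 0 <= s], continuous x}.
Hypothesis zx : forall t, 0 <= t -> mu (`[0%R, t] `&` [set s | x s = 0]) = 0%E.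
Hypothesis fx : forall t, 0 <= t -> (\int[mu]_(s in `[0%R, t]%classic) ((x s)^-1)%:E < +oo)%E.

Definition Iinv t := fine (\int[mu]_(s in `[0%R, t]%classic) ((x s)^-1)%:E).

Let D : set R := `[0%R, +oo[%classic.

Lemma measurable_path : measurable_fun D x.
Proof.
have cD : {within D, continuous x}.
  have sub : D `<=` [set s | 0 <= s] by move=> s; rewrite /D/= in_itv/= andbT.
  exact: (continuous_subspaceW sub cx).
exact: (subspace_continuous_measurable_fun (measurable_itv _) cD).
Qed.

Lemma measurable_inv_path (A : set R) : measurable A -> A `<=` D ->
  measurable_fun A (fun s => ((x s)^-1)%:E).
Proof.
move=> mA AD; apply/measurable_EFinP.
apply: (@measurable_funS _ _ _ _ D) => //; first exact: measurable_itv.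
exact: (measurableT_comp measurable_invR measurable_path).
Qed.

Lemma inv_path_ge0 s : D s -> (0 <= ((x s)^-1)%:E)%E.
Proof. by rewrite /D/= in_itv/= andbT => s0; rewrite lee_fin invr_ge0 x0. Qed.

Lemma IinvB s t : 0 <= s -> s <= t ->
  [/\ (\int[mu]_(u in `]s, t]%classic) ((x u)^-1)%:E < +oo)%E &
  Iinv t - Iinv s = fine (\int[mu]_(u in `]s, t]%classic) ((x u)^-1)%:E)].
Proof.
move=> s0 st; have t0 := le_trans s0 st.
have sub1 : `[0%R, t]%classic `<=` D.
  by move=> u; rewrite /D/= !in_itv/= => /andP[->].
have sub2 : `]s, t]%classic `<=` `[0%R, t]%classic.
  by move=> u; rewrite /= !in_itv/= => /andP[su ->]; rewrite (le_trans s0 (ltW su)).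
have lt2 : (\int[mu]_(u in `]s, t]%classic) ((x u)^-1)%:E < +oo)%E.
  apply: le_lt_trans (fx t0); apply: ge0_subset_integral => //.
  - exact: measurable_inv_path.
  - by move=> u /sub1; exact: inv_path_ge0.
split=> //.
have e : (\int[mu]_(u in `[0%R, t]%classic) ((x u)^-1)%:E =
   \int[mu]_(u in `[0%R, s]%classic) ((x u)^-1)%:E +
   \int[mu]_(u in `]s, t]%classic) ((x u)^-1)%:E)%E.
  rewrite (@itv_bndbnd_setU _ _ (BLeft 0) (BRight s) (BRight t)) ?bnd_simp//.
  rewrite ge0_integral_setU//.
  - apply: measurable_inv_path; first exact: measurableU.
    rewrite -itv_bndbnd_setU ?bnd_simp//.
  - rewrite -itv_bndbnd_setU ?bnd_simp// => u /sub1; exact: inv_path_ge0.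
  - apply/disj_setPS => u [] /=; rewrite !in_itv/= => /andP[_ us] /andP[su _].
    by move: (lt_le_trans su us); rewrite ltxx.
have fin (A : set R) : (A `<=` D) -> (\int[mu]_(u in A) ((x u)^-1)%:E < +oo)%E ->
    (\int[mu]_(u in A) ((x u)^-1)%:E)%E \is a fin_num.
  move=> AD h; rewrite ge0_fin_numE//.
  by apply: integral_ge0 => u /AD; exact: inv_path_ge0.
have f1 : (\int[mu]_(u in `[0%R, s]%classic) ((x u)^-1)%:E)%E \is a fin_num.
  by apply: fin (fx s0) => u; rewrite /D/= !in_itv/= => /andP[->].
have f2 : (\int[mu]_(u in `]s, t]%classic) ((x u)^-1)%:E)%E \is a fin_num.
  by apply: fin lt2 => u /sub2; exact: sub1.
by rewrite /Iinv e fineD// addrC addKr.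
Qed.

Lemma Iinv_mono s t : 0 <= s -> s <= t -> Iinv s <= Iinv t.
Proof.
move=> s0 st; rewrite -subr_ge0; have [_ ->] := IinvB s0 st.
apply/fine_ge0/integral_ge0 => u /=; rewrite in_itv/= => /andP[su _].
by rewrite lee_fin invr_ge0 x0// (le_trans s0 (ltW su)).
Qed.

Lemma Iinv_lower s t m : 0 <= s -> s < t -> 0 < m ->
  (forall u : rat, s <= ratr u <= t -> x (ratr u) <= m) -> (t - s) / m <= Iinv t - Iinv s.
Proof.
move=> s0 st m0 xm; have [lt ->] := IinvB s0 (ltW st).
have t0 := le_trans s0 (ltW st).
(* As [0^-1 = 0], the bound [m^-1 <= (x u)^-1] fails on the zeros of [x]; they form a null set and
   are removed. The interval is opened because [within_rat_le] gives [x <= m] only in its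
   interior. *)
set Z := `[0%R, t] `&` [set s | x s = 0].
have subD : `]s, t]%classic `<=` D.
  by move=> u; rewrite /D/= !in_itv/= => /andP[su _]; rewrite (le_trans s0 (ltW su)).
have mZ : measurable Z.
  rewrite /Z (_ : _ `&` _ = `[0%R, t] `&` (D `&` x @^-1` [set 0])).
    apply: measurableI; first exact: measurable_itv.
    exact: (measurable_path (measurable_itv _) (measurable_set1 _)).
  apply/seteqP; split=> u /=; rewrite !in_itv/=.
    by move=> [/andP[u0 ut] xu]; rewrite u0 ut; split=> //; rewrite /D/= in_itv/= u0.
  by move=> [? [_ ?]].
set A := `]s, t[%classic `\` Z.
have mA : measurable A by exact: measurableD.
have Asub : A `<=` `]s, t]%classic.
  by move=> u [/=]; rewrite !in_itv/= => /andP[-> /ltW ->].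
rewrite -lee_fin fineK; last first.
  rewrite ge0_fin_numE//; apply: integral_ge0 => u /subD; exact: inv_path_ge0.
apply: (@le_trans _ _ (\int[mu]_(u in A) ((x u)^-1)%:E)%E); last first.
  apply: ge0_subset_integral => //; first exact: measurable_inv_path.
  by move=> u /subD; exact: inv_path_ge0.
apply: (@le_trans _ _ (\int[mu]_(u in A) (m^-1)%:E)%E); last first.
  apply: ge0_le_integral => //.
  - by move=> u _; rewrite lee_fin invr_ge0 ltW.
  - by apply: measurable_inv_path => // u /Asub/subD.
  - move=> u [/= su nz]; rewrite lee_fin.
    move: su; rewrite in_itv/= => su.
    have xu : x u <= m by exact: (within_rat_le cx s0 xm).
    have u0 : 0 <= u by case/andP: su => su _; exact: le_trans s0 (ltW su).
    have xu0 : 0 < x u.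
      rewrite lt_neqAle x0// andbT eq_sym; apply/eqP => xz; apply: nz.
      by split=> //=; rewrite in_itv/= u0; case/andP: su => _ /ltW.
    by rewrite lef_pV2 ?posrE.
rewrite integral_cst// mulrC EFinM lee_wpmul2l ?lee_fin ?invr_ge0 ?(ltW m0)//.
have -> : (t - s)%:E = mu `]s, t[%classic.
  by rewrite lebesgue_measure_itv/= lte_fin st EFinB.
apply: (@le_trans _ _ (mu (A `|` Z))).
  apply: le_measure; rewrite ?inE//; first exact: measurableU.
  by move=> u su; have [uz|uz] := pselect (Z u); [right|left].
have zZ : (mu Z <= 0)%E by rewrite (zx t0).
apply: (le_trans (measureU2 mu mA mZ)).
by rewrite -[leRHS]adde0; apply: leeD.
Qed.

End InverseIntegral.

Lemma good_path_intro (al be ga de : R) x y b c :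
  (forall t, 0 <= t -> 0 <= x t /\ 0 <= y t) ->
  {within [set s | 0 <= s], continuous x} -> {within [set s | 0 <= s], continuous y} ->
  {within [set s | 0 <= s], continuous b} -> {within [set s | 0 <= s], continuous c} ->
  (forall t, 0 <= t -> mu (`[0%R, t] `&` [set s | x s = 0]) = 0%E) ->
  (forall t, 0 <= t -> mu (`[0%R, t] `&` [set s | y s = 0]) = 0%E) ->
  (forall t, 0 <= t -> (\int[mu]_(s in `[0%R, t]%classic) ((x s)^-1)%:E < +oo)%E) ->
  (forall t, 0 <= t -> (\int[mu]_(s in `[0%R, t]%classic) ((y s)^-1)%:E < +oo)%E) ->
  (forall t, 0 <= t -> x t = x 0 + b t + al * Iinv x t + be * Iinv y t) ->
  (forall t, 0 <= t -> y t = y 0 + c t + ga * Iinv x t + de * Iinv y t) ->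
  good_path al be ga de x y b c.
Proof.
move=> xy0 cx cy cb cc zx zy fx fy ex ey.
have x0 t : 0 <= t -> 0 <= x t by move=> /xy0[].
have y0 t : 0 <= t -> 0 <= y t by move=> /xy0[].
have unif T e : 0 < e -> exists2 dl, 0 < dl &
    forall s t, 0 <= s <= T -> 0 <= t <= T -> `|s - t| < dl ->
    [/\ `|x s - x t| <= e, `|y s - y t| <= e, `|b s - b t| <= e & `|c s - c t| <= e].
  move=> e0; have [d1 d10 h1] := @within_unif x T e cx e0.
  have [d2 d20 h2] := @within_unif y T e cy e0.
  have [d3 d30 h3] := @within_unif b T e cb e0.
  have [d4 d40 h4] := @within_unif c T e cc e0.
  exists (Num.min (Num.min d1 d2) (Num.min d3 d4)); first by rewrite !lt_min d10 d20 d30.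
  move=> s t sT tT; rewrite !lt_min => /andP[/andP[? ?] /andP[? ?]].
  by split; [exact: h1|exact: h2|exact: h3|exact: h4].
exists (Iinv x), (Iinv y); split=> //.
- by move=> s t s0 st; rewrite (ex t (le_trans s0 st)) (ex s s0); ring.
- by move=> s t s0 st; rewrite (ey t (le_trans s0 st)) (ey s s0); ring.
- by move=> s t m; apply: Iinv_lower.
- by move=> s t m; apply: Iinv_lower.
- by move=> s t; apply: Iinv_mono.
- by move=> s t; apply: Iinv_mono.
- move=> T; have [M1 h1] := within_bounded T cx; have [M2 h2] := within_bounded T cy.
  exists (Num.max M1 M2) => t tT.
  by rewrite !le_max h1// h2// orbT.
- move=> t t0.
  have [s /andP[s0 st] [xs ys]] : exists2 s, 0 < s < t & 0 < x s /\ 0 < y s.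
    (* Otherwise the two null zero sets would cover an interval of positive length. *)
    apply: contrapT => hn.
    set Zx := `[0%R, t] `&` [set s | x s = 0]; set Zy := `[0%R, t] `&` [set s | y s = 0].
    have mZ (z : R -> R) : {within [set s | 0 <= s], continuous z} ->
        measurable (`[0%R, t] `&` [set s | z s = 0]).
      move=> cz; rewrite (_ : _ `&` _ = `[0%R, t] `&` (`[0%R, +oo[%classic `&` z @^-1` [set 0])).
        apply: measurableI; first exact: measurable_itv.
        exact: (measurable_path cz (measurable_itv _) (measurable_set1 _)).
      apply/seteqP; split=> u /=; rewrite !in_itv/=.
        by move=> [/andP[u0 ut] xu]; rewrite u0 ut.
      by move=> [? [_ ?]].
    have : (mu `]0%R, t[%classic <= 0)%E.
      apply: (@le_trans _ _ (mu (Zx `|` Zy))).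
        apply: le_measure; rewrite ?inE//; first by apply: measurableU; exact: mZ.
        move=> u /=; rewrite in_itv/= => /andP[u0 ut].
        have xu := x0 u (ltW u0); have yu := y0 u (ltW u0).
        have [xz|xz] := eqVneq (x u) 0; first by left; split=> //=; rewrite in_itv/= !ltW.
        have [yz|yz] := eqVneq (y u) 0; first by right; split=> //=; rewrite in_itv/= !ltW.
        exfalso; apply: hn; exists u; first by rewrite u0.
        by rewrite !lt_neqAle eq_sym xz xu eq_sym yz yu.
      have zZx : (mu Zx <= 0)%E by rewrite (zx t (ltW t0)).
      have zZy : (mu Zy <= 0)%E by rewrite (zy t (ltW t0)).
      apply: (le_trans (measureU2 mu (mZ x cx) (mZ y cy))).
      by rewrite -[leRHS]adde0; apply: leeD.
    rewrite lebesgue_measure_itv/= lte_fin t0 -EFinB lee_fin subr0.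
    by rewrite leNgt t0.
  (* A rational time close to [s] changes each coordinate by at most half of its value, hence both
     stay positive. *)
  pose e := Num.min (x s) (y s) / 2.
  have e0 : 0 < e by rewrite divr_gt0// lt_min xs.
  have [dl dl0 h] := unif t e e0.
  have lt1 : s < Num.min t (s + dl) by rewrite lt_min st/= ltrDl.
  have [v] := rat_in_itvoo lt1; rewrite in_itv/= lt_min => /andP[sv /andP[vt vdl]].
  exists v; first by apply/andP; split; lra.
  have [||| + + _ _] := h s (ratr v); [apply/andP; split; lra..| |].
    by rewrite distrC ger0_norm; lra.
  have e1 : e <= x s / 2 by rewrite ler_pM2r// ge_min lexx.
  have e2 : e <= y s / 2 by rewrite ler_pM2r// ge_min lexx orbT.
  by rewrite !ler_norml => /andP[_ ?] /andP[_ ?]; split; lra.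
Qed.

End PathRegularity.

(** * The linear and the quadratic Lyapunov function *)

Section LyapunovInstances.
Context {R : realType}.
Implicit Types (f g : R -> R -> R).

Lemma meas2M f g : meas2 f -> meas2 g -> meas2 (fun x y => f x y * g x y).
Proof. by move=> mf mg d T x y mx my; apply: measurable_funM; [exact: mf|exact: mg]. Qed.

Lemma meas2D f g : meas2 f -> meas2 g -> meas2 (fun x y => f x y + g x y).
Proof. by move=> mf mg d T x y mx my; apply: measurable_funD; [exact: mf|exact: mg]. Qed.

Lemma meas2B f g : meas2 f -> meas2 g -> meas2 (fun x y => f x y - g x y).
Proof. by move=> mf mg d T x y mx my; apply: measurable_funB; [exact: mf|exact: mg]. Qed.

Lemma meas2C (k : R) : meas2 (fun _ _ => k).
Proof. by move=> d T x y mx my; exact: measurable_cst. Qed.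

Lemma meas2x : meas2 (fun x _ : R => x). Proof. by []. Qed.

Lemma meas2y : meas2 (fun _ y : R => y). Proof. by []. Qed.

Lemma meas2V f : meas2 f -> meas2 (fun x y => (f x y)^-1).
Proof.
move=> mf d T x y mx my.
exact: (measurableT_comp (@measurable_invR R) (mf _ _ _ _ mx my)).
Qed.

(** Cauchy-Schwarz for the pairs [(a / X, b / Y)] and [(la * X, mu * Y)]; after expansion it is the
    arithmetic-geometric inequality for the cross terms [A] and [B], whose product is
    [la * a * mu * b]. *)
Lemma sqrt_cauchy (la mu a b X Y : R) : 0 <= la -> 0 <= mu -> 0 <= a -> 0 <= b ->
  0 < X -> 0 < Y ->
  (Num.sqrt (la * a) + Num.sqrt (mu * b)) ^+ 2 <= (a / X + b / Y) * (la * X + mu * Y).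
Proof.
move=> la0 mu0 a0 b0 X0 Y0.
have -> : (a / X + b / Y) * (la * X + mu * Y) =
  la * a + mu * b + (a * mu * Y / X + b * la * X / Y).
  by field; rewrite !gt_eqF.
rewrite sqrrD !sqr_sqrtr ?mulr_ge0//.
set A := a * mu * Y / X; set B := b * la * X / Y.
have A0 : 0 <= A by rewrite !mulr_ge0 ?invr_ge0// ltW.
have B0 : 0 <= B by rewrite !mulr_ge0 ?invr_ge0// ltW.
have -> : Num.sqrt (la * a) * Num.sqrt (mu * b) = Num.sqrt A * Num.sqrt B.
  rewrite -(sqrtrM _ (mulr_ge0 la0 a0)) -(sqrtrM _ A0); congr (Num.sqrt _).
  rewrite /A /B.
  by field; rewrite !gt_eqF.
have := sqr_ge0 (Num.sqrt A - Num.sqrt B).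
by rewrite sqrrB !sqr_sqrtr//; lra.
Qed.

(** The drift [a / X + b' / Y] of [Phi] is at least [c0 / Phi], and the noise has variance rate
    [la ^+ 2 + mu ^+ 2 + 2 * rho * la * mu]; so the drift of [- ln Phi] has the sign of half that
    rate minus [c0]. There is no second-order term ([s = 0]) and no excess ([C = 0]). *)
Lemma lyapunov_linear (al be ga de rho la mu : R) :
  0 <= la -> 0 <= mu -> 0 < la + mu ->
  0 <= la * al + mu * ga -> 0 <= la * be + mu * de ->
  (Num.sqrt (la * (la * al + mu * ga)) + Num.sqrt (mu * (la * be + mu * de))) ^+ 2
    >= 1 / 2 * (la ^+ 2 + mu ^+ 2 + 2 * rho * la * mu) ->
  lyapunov al be ga de rho (fun x y => la * x + mu * y).
Proof.
move=> la0 mu0 lm0; set a := la * al + mu * ga; set b' := la * be + mu * de.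
move=> a0 b0; set c0 := (_ + _) ^+ 2 => hc.
have c00 : 0 <= c0 by exact: sqr_ge0.
have mPhi : meas2 (fun x y : R => la * x + mu * y).
  exact: (meas2D (meas2M (meas2C la) meas2x) (meas2M (meas2C mu) meas2y)).
split=> //.
- by move=> x y x0 y0; rewrite addr_ge0// mulr_ge0.
- move=> x y x0 y0.
  have : 0 < (la + mu) * Num.min x y by rewrite mulr_gt0// lt_min x0.
  move=> /lt_le_trans; apply; rewrite mulrDl lerD// ler_wpM2l// ge_min lexx ?orbT//.
- move=> N; exists (la * N + mu * N) => x y /andP[_ xN] /andP[_ yN].
  by rewrite lerD// ler_wpM2l.
- move=> ka ka0; exists (ka / (la + mu)); first by rewrite divr_gt0.
  move=> x y /andP[_ xe] /andP[_ ye].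
  apply: (@le_trans _ _ ((la + mu) * (ka / (la + mu)))).
    by rewrite [leRHS]mulrDl lerD// ler_wpM2l.
  by rewrite mulrC divfK// gt_eqF.
move=> N ka N0 ka0; exists 0 => // k2 k20.
exists (la / ka + mu / ka + c0 / ka ^+ 2) => th /andP[th0 _].
(* Makes [la * (x + r) + mu * (y + r) <= Phi x y + ka], so the shift by [r] in the denominators is
   absorbed by [ka]. *)
exists (ka / (la + mu)); first by rewrite divr_gt0.
move=> r /andP[r0 rk].
pose u (x y : R) := la * x + mu * y + ka.
have mu_ : meas2 (fun x y => (u x y)^-1) by exact: (meas2V (meas2D mPhi (meas2C ka))).
exists (fun x y => la * (u x y)^-1), (fun x y => mu * (u x y)^-1), (fun _ _ => 0),
  (fun x y => c0 * ((u x y)^-1 * (u x y)^-1)).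
split.
  split; [exact: (meas2M (meas2C _) mu_)|exact: (meas2M (meas2C _) mu_)|exact: meas2C|].
  exact: (meas2M (meas2C _) (meas2M mu_ mu_)).
move=> x y /andP[x0 xN] /andP[y0 yN].
have uka : ka <= u x y by rewrite /u lerDr addr_ge0// mulr_ge0.
have u0 : 0 < u x y by exact: lt_le_trans uka.
set v := (u x y)^-1.
have v0 : 0 < v by rewrite invr_gt0.
have vka : v <= ka^-1 by rewrite lef_pV2 ?posrE.
have k0 : 0 < ka^-1 by rewrite invr_gt0.
have b1 : 0 <= la * v <= la / ka by rewrite mulr_ge0 ?(ltW v0)//= ler_wpM2l.
have b2 : 0 <= mu * v <= mu / ka by rewrite mulr_ge0 ?(ltW v0)//= ler_wpM2l.
have b3 : 0 <= c0 * (v * v) <= c0 / ka ^+ 2.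
  rewrite !mulr_ge0 ?(ltW v0)//= ler_wpM2l// -exprVn expr2.
  by rewrite ler_pM ?(ltW v0).
case/andP: b1 => b11 b12; case/andP: b2 => b21 b22; case/andP: b3 => b31 b32.
split.
- by rewrite normr0 !ger0_norm//; split; lra.
- rewrite mul0r mulr0 !add0r.
  rewrite (_ : _ + _ = (1 / 2 * (la ^+ 2 + mu ^+ 2 + 2 * rho * la * mu) - c0)
    * (v * v)); last by field.
  rewrite (le_trans _ (ltW th0))// mulr_le0_ge0 ?mulr_ge0 ?(ltW v0)//; lra.
move=> x' y' b c h I J x'0 y'0 _ _ h0 hI hJ x'E y'E.
rewrite -[la * x + mu * y + ka]/(u x y).
have -> : u x y * (1 + (la * v * b + mu * v * c + 0 * (b ^+ 2 + c ^+ 2) + c0 * (v * v) * h))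
  = u x y + la * b + mu * c + c0 * h * v.
  by rewrite /v; field; rewrite gt_eqF.
have -> : la * x' + mu * y' + ka = u x y + la * b + mu * c + (a * I + b' * J).
  by rewrite x'E y'E /u /a /b'; ring.
rewrite lerD2l.
have xr : 0 < x + r by lra.
have yr : 0 < y + r by lra.
have h1 : a * (h / (x + r)) + b' * (h / (y + r)) <= a * I + b' * J.
  by rewrite lerD// ler_wpM2l.
apply: le_trans h1.
have cs := sqrt_cauchy la0 mu0 a0 b0 xr yr.
have w0 : 0 < la * (x + r) + mu * (y + r).
  have : 0 < (la + mu) * r by rewrite mulr_gt0.
  have := mulr_ge0 la0 x0; have := mulr_ge0 mu0 y0; lra.
have wu : la * (x + r) + mu * (y + r) <= u x y.
  rewrite /u; move: rk; rewrite ler_pdivlMr//; lra.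
have c1 : c0 * v <= a / (x + r) + b' / (y + r).
  rewrite ler_pdivrMr// (le_trans cs)// ler_wpM2l//.
  by apply: addr_ge0; apply: divr_ge0 => //; exact: ltW.
rewrite (_ : c0 * h * v = h * (c0 * v)); last by ring.
rewrite (_ : _ + _ = h * (a / (x + r) + b' / (y + r))); last by ring.
by rewrite ler_wpM2l.
Qed.

(** Used near the axes, where only the sign of the drift is kept. Squaring is not monotone if
    [s + e < 0], but then the left side is nonpositive. *)
Lemma sqr_step_ge (s s' e : R) : 0 <= s -> 0 <= s' -> s + e <= s' ->
  s ^+ 2 + 2 * s * e <= s' ^+ 2.
Proof.
move=> s0 s'0 ss'; have [se|se] := leP 0 (s + e).
  apply: (@le_trans _ _ ((s + e) ^+ 2)); last by rewrite lerXn2r ?nnegrE.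
  by rewrite sqrrD; have := sqr_ge0 e; lra.
apply: (@le_trans _ _ 0); last exact: sqr_ge0.
rewrite (_ : _ + _ = s * (s + 2 * e)); last by ring.
by rewrite mulr_ge0_le0//; lra.
Qed.

(** Away from the axis, [(s + e) * h / (s + r)] is at least [h] up to the factor [1 - 2 * r / k2],
    because [(s - r) / (s + r) = 1 - 2 * r / (s + r)]. So [2 * s * ds] recovers the full Ito drift
    as [r] tends to [0]. *)
Lemma sqr_step_ge_drift (k k2 r h s s' e E : R) : 0 < k -> 0 < k2 -> 0 < r <= k2 / 2 ->
  0 <= h -> k2 <= s -> `|e| <= r -> 0 <= s' ->
  h / (s + r) <= E -> s + e + k * E <= s' ->
  s ^+ 2 + 2 * s * e + e ^+ 2 + 2 * k * (1 - 2 * r / k2) * h <= s' ^+ 2.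
Proof.
move=> kk0 k20 /andP[r0 rk] h0 ks; rewrite ler_norml => /andP[er1 er2] s'0 hE ss'.
have sr : 0 < s + r by lra.
have se : 0 <= s + e by lra.
have hs0 : 0 <= h / (s + r) by rewrite divr_ge0// ltW.
set H := h / (s + r) in hE hs0.
have w1 : s + e + k * H <= s'.
  by apply: le_trans ss'; rewrite lerD2l ler_pM2l.
have kH : 0 <= k * H by rewrite mulr_ge0// ltW.
apply: (@le_trans _ _ ((s + e + k * H) ^+ 2)); last first.
  by rewrite lerXn2r ?nnegrE//; lra.
set z := 1 - 2 * r / k2.
have zs : z * h <= (s + e) * H.
  rewrite /H mulrCA mulrC ler_wpM2l// ler_pdivlMr//.
  apply: (@le_trans _ _ (s - r)); last lra.
  rewrite /z mulrBl mul1r lerBlDr.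
  have : 2 * r / k2 * k2 <= 2 * r / k2 * (s + r).
    by rewrite ler_wpM2l ?divr_ge0 ?(ltW k20)//; lra.
  by rewrite divfK ?gt_eqF//; lra.
rewrite (sqrrD (s + e)) (sqrrD s).
have : k * (z * h) <= k * ((s + e) * H) by rewrite ler_pM2l.
have := sqr_ge0 (k * H); lra.
Qed.

(** The nonnegative cross drifts are dropped. With both coordinates above [k2],
    [2 * rho * x * y <= A * (x ^+ 2 + y ^+ 2)] bounds the drift of [- ln (Phi + ka)] by
    [2 * A * (1 - z) / u]; below [k2] the second-order gain is given up and charged to [bad]. *)
Lemma lyapunov_quadratic (al be ga de rho : R) :
  0 <= be -> 0 <= ga -> 0 < al -> 0 < de -> rho <= 1 -> rho <= al + de ->
  lyapunov al be ga de rho (fun x y => x ^+ 2 + y ^+ 2).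
Proof.
move=> be0 ga0 al0 de0 rho1 rhoad.
have mPhi : meas2 (fun x y : R => x ^+ 2 + y ^+ 2).
  exact: (meas2D (meas2M meas2x meas2x) (meas2M meas2y meas2y)).
have sqle (x e : R) : 0 <= x <= e -> x ^+ 2 <= e ^+ 2.
  by move=> /andP[x0 xe]; rewrite lerXn2r ?nnegrE//; exact: le_trans xe.
split=> //.
- by move=> x y _ _; rewrite addr_ge0// sqr_ge0.
- by move=> x y x0 y0; rewrite addr_gt0// exprn_gt0.
- move=> N; exists (N ^+ 2 + N ^+ 2) => x y xN yN.
  by rewrite lerD// sqle.
- move=> ka ka0; exists (Num.sqrt (ka / 2)); first by rewrite sqrtr_gt0 divr_gt0.
  move=> x y xe ye; have := sqle _ _ xe; have := sqle _ _ ye.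
  by rewrite sqr_sqrtr ?divr_ge0 ?(ltW ka0)//; lra.
(* Without the second-order gain the drift is half the squared noise of [ln u], at most
   [4 * u / u ^+ 2 <= 4 / ka], independently of [k2]. *)
move=> N ka N0 ka0; exists (4 / ka); first by rewrite divr_ge0// ltW.
move=> k2 k20; set A := al + de.
have A0 : 0 < A by rewrite /A; lra.
exists ((2 * N + 1 + 2 * A) / ka) => th /andP[th0 _].
(* The first bound gives [0 <= z]; the second makes the residual drift [4 * A * r / (k2 * u)] at
   most [th]. *)
exists (Num.min (k2 / 2) (th * k2 * ka / (4 * A))).
  by rewrite lt_min !divr_gt0// !mulr_gt0.
move=> r; rewrite le_min => /andP[r0 /andP[rk rth]].
pose u (x y : R) := x ^+ 2 + y ^+ 2 + ka.
have mu_ : meas2 (fun x y => (u x y)^-1) by exact: (meas2V (meas2D mPhi (meas2C ka))).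
have mg : meas2 (fun x y : R => 1 - bad k2 x y) by exact: (meas2B (meas2C 1) (meas2_bad k2)).
pose z := 1 - 2 * r / k2.
have z0 : 0 <= z by rewrite /z subr_ge0 ler_pdivrMr//; lra.
have z1 : z <= 1 by rewrite /z gerBl divr_ge0 ?(ltW k20)//; lra.
exists (fun x y => 2 * x * (u x y)^-1), (fun x y => 2 * y * (u x y)^-1),
  (fun x y => (1 - bad k2 x y) * (u x y)^-1),
  (fun x y => (1 - bad k2 x y) * (2 * A * z * (u x y)^-1)).
split.
  split; [exact: (meas2M (meas2M (meas2C _) meas2x) mu_)|
    exact: (meas2M (meas2M (meas2C _) meas2y) mu_)|exact: (meas2M mg mu_)|].
  exact: (meas2M mg (meas2M (meas2C _) mu_)).
move=> x y /andP[x0 xN] /andP[y0 yN].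
have x2 := sqr_ge0 x; have y2 := sqr_ge0 y.
have uka : ka <= u x y by rewrite /u; lra.
have u0 : 0 < u x y by exact: lt_le_trans uka.
set v := (u x y)^-1.
have v0 : 0 < v by rewrite invr_gt0.
have vka : v <= ka^-1 by rewrite lef_pV2 ?posrE.
have k0 : 0 < ka^-1 by rewrite invr_gt0.
have uv : u x y * v = 1 by rewrite mulfV// gt_eqF.
have mono (k : R) : 0 <= k <= 2 * N + 1 + 2 * A -> `|k * v| <= (2 * N + 1 + 2 * A) / ka.
  move=> /andP[k00 kN]; rewrite ger0_norm ?mulr_ge0 ?(ltW v0)//.
  by rewrite ler_pM// ltW.
have Az : 0 <= A * z <= A by rewrite mulr_ge0 ?(ltW A0)//= ler_piMr// ltW.
case/andP: Az => Az0 Az1.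
have xy0 : 0 <= x * y by rewrite mulr_ge0.
have xy2 : 2 * (x * y) <= x ^+ 2 + y ^+ 2 by have := sqr_ge0 (x - y); rewrite sqrrB; lra.
split.
- have bb : (1 - bad k2 x y = 0) \/ (1 - bad k2 x y = 1).
    by rewrite /bad; case: (_ || _) => /=; [left; rewrite subrr|right; rewrite subr0].
  split; [by apply: mono; apply/andP; split; lra..| |].
    by case: bb => ->; apply: mono; apply/andP; split; lra.
  rewrite mulrA; case: bb => ->; rewrite ?mul0r ?mul1r.
    by rewrite normr0 divr_ge0 ?(ltW ka0)//; lra.
  by apply: mono; rewrite -mulrA; apply/andP; split; lra.
- have rxy : 2 * rho * x * y <= A * (x ^+ 2 + y ^+ 2).
    have [r0'|r0'] := leP 0 rho.
      apply: (@le_trans _ _ (A * (2 * (x * y)))); last by rewrite ler_wpM2l// ltW.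
      by rewrite (_ : 2 * rho * x * y = rho * (2 * (x * y))) ?ler_wpM2r//; [lra|ring].
    have : rho * (x * y) <= 0 by rewrite mulr_le0_ge0// ltW.
    have : 0 <= A * (x ^+ 2 + y ^+ 2) by rewrite mulr_ge0 ?(ltW A0)//; lra.
    lra.
  have rxy1 : 2 * rho * x * y <= x ^+ 2 + y ^+ 2.
    have : rho * (x * y) <= 1 * (x * y) by rewrite ler_wpM2r.
    lra.
  rewrite (_ : 1 / 2 * _ = 2 * (x ^+ 2 + y ^+ 2 + 2 * rho * x * y) * (v * v)); last by field.
  have uvv : u x y * (v * v) = v by rewrite mulrA uv mul1r.
  have vv0 : 0 <= v * v by rewrite mulr_ge0 ?(ltW v0).
  rewrite /bad; case: (_ || _) => /=.
    rewrite subrr !mul0r mulr0 !addr0 oppr0 add0r mulr1.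
    have : 2 * (x ^+ 2 + y ^+ 2 + 2 * rho * x * y) * (v * v) <= 4 * u x y * (v * v).
      by rewrite ler_wpM2r// /u; lra.
    rewrite -(mulrA 4) uvv; lra.
  rewrite subr0 !mul1r mulr0 add0r.
  have h1 : 2 * (x ^+ 2 + y ^+ 2 + 2 * rho * x * y) * (v * v) <= 2 * (1 + A) * u x y * (v * v).
    rewrite ler_wpM2r// /u.
    have : 0 <= A * ka by rewrite mulr_ge0// ltW.
    lra.
  rewrite -(mulrA (2 * (1 + A))) uvv in h1.
  have h2 : 4 * A * r / k2 * v <= th.
    apply: (@le_trans _ _ (4 * A * r / k2 * ka^-1)).
      by rewrite ler_wpM2l// !mulr_ge0 ?invr_ge0 ?(ltW A0) ?(ltW k20)//; lra.
    rewrite !ler_pdivrMr//; move: rth; rewrite ler_pdivlMr ?mulr_gt0//; lra.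
  have e1 : 2 * A * z * v = 2 * A * v - 4 * A * r / k2 * v.
    by rewrite /z; field; rewrite gt_eqF.
  lra.
move=> x' y' b c h I J x'0 y'0 br cr h0 hI hJ x'E y'E.
rewrite -[x ^+ 2 + y ^+ 2 + ka]/(u x y).
set gb := 1 - bad k2 x y.
have -> : u x y * (1 + (2 * x * v * b + 2 * y * v * c + gb * v * (b ^+ 2 + c ^+ 2)
    + gb * (2 * A * z * v) * h))
  = u x y + 2 * x * b + 2 * y * c + gb * (b ^+ 2 + c ^+ 2 + 2 * A * z * h).
  by rewrite /v; field; rewrite gt_eqF.
have xr : 0 < x + r by lra.
have yr : 0 < y + r by lra.
have I0 : 0 <= I by apply: le_trans hI; rewrite divr_ge0// ltW.
have J0 : 0 <= J by apply: le_trans hJ; rewrite divr_ge0// ltW.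
have alI : x + b + al * I <= x'.
  by rewrite x'E lerDl mulr_ge0.
have deJ : y + c + de * J <= y'.
  by rewrite y'E; have : 0 <= ga * I by [rewrite mulr_ge0]; lra.
rewrite /gb /bad /u; case: (boolP ((x < k2) || (y < k2))) => [_|].
  rewrite /= subrr mul0r addr0.
  have l1 : x ^+ 2 + 2 * x * b <= x' ^+ 2.
    apply: sqr_step_ge => //; apply: le_trans alI.
    by rewrite lerDl mulr_ge0// ltW.
  have l2 : y ^+ 2 + 2 * y * c <= y' ^+ 2.
    apply: sqr_step_ge => //; apply: le_trans deJ.
    by rewrite lerDl mulr_ge0// ltW.
  by clear -l1 l2; lra.
rewrite negb_or -!leNgt => /andP[xk yk]; rewrite /= subr0 mul1r /A.
have rk' : 0 < r <= k2 / 2 by rewrite r0.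
have l1 := sqr_step_ge_drift al0 k20 rk' h0 xk br x'0 hI alI.
have l2 := sqr_step_ge_drift de0 k20 rk' h0 yk cr y'0 hJ deJ.
by rewrite /z; clear -l1 l2; lra.
Qed.

End LyapunovInstances.

(** * Passage to the limit and countable covering *)

Section Avoidance.
Context {d : measure_display} {Om : measurableType d} {R : realType}.
Variable P : probability Om R.
Variable F : R -> set (set Om).
Variables (al be ga de rho : R) (B C X Y : R -> Om -> R) (Om0 : set Om).
Variable Phi : R -> R -> R.
Hypothesis fF : filtration F.
Hypothesis rho1 : -1 <= rho.
Hypothesis aB : adapted F B.
Hypothesis aC : adapted F C.
Hypothesis aX : adapted F X.
Hypothesis aY : adapted F Y.
Hypothesis mgf : forall s t, 0 <= s -> s <= t -> forall A, F s A -> forall u1 u2 : R,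
   (\int[P]_(w in A) (expR (u1 * (B t w - B s w) + u2 * (C t w - C s w)))%:E
    = P A * (expR ((t - s) / 2 * (u1 ^+ 2 + 2 * rho * u1 * u2 + u2 ^+ 2)))%:E)%E.
Hypothesis FOm0 : F 0 Om0.
Hypothesis goodOm0 : forall w, Om0 w ->
  good_path al be ga de (X ^~ w) (Y ^~ w) (B ^~ w) (C ^~ w).
Hypothesis lyP : lyapunov al be ga de rho Phi.

Lemma step_data_weaken (N ka Cc k2 K K' th r : R) (p q s m : R -> R -> R) : K <= K' ->
  step_data al be ga de rho Phi N ka Cc k2 K th r p q s m ->
  step_data al be ga de rho Phi N ka Cc k2 K' th r p q s m.
Proof.
move=> KK' [ms sd]; split=> // x y xN yN; have [[? ? ? ?] ? ?] := sd x y xN yN.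
by split=> //; split; apply: le_trans KK'.
Qed.

Lemma exists_nat_gt (x : R) : exists n : nat, x < n%:R.
Proof. by exists (Num.trunc x).+1; exact: truncnS_gt. Qed.

(** Quantification over real times leaves measurability open, so this set is only ever covered by
    measurable ones. *)
Definition hits (q T eta N : R) : set Om := [set w | [/\ Om0 w,
  eta <= Phi (X q w) (Y q w),
  (forall t, q <= t <= q + T -> X t w <= N /\ Y t w <= N) &
  (exists2 t, q <= t <= q + T & X t w = 0 /\ Y t w = 0)]].

(** The admissible level and mesh depend on the path, so the cover is a limit inferior over meshes
    inside a limit inferior over levels. The final [2] is [Cc * eps <= 1] plus the accumulated error
    [1]. *)
Lemma hits_cover (q T eta N M ka : R) : 0 <= q -> 1 <= T -> 0 < eta <= 1 -> 0 <= N ->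
  0 <= M -> (forall x y, 0 <= x <= N -> 0 <= y <= N -> Phi x y <= M) ->
  0 < ka <= 1 -> 0 <= 1 + ln (M + 1) - ln (2 * ka) ->
  exists V, [/\ measurable V, hits q T eta N `<=` V &
    (1 + ln (M + 1) - ln (2 * ka)) * fine (P V) <= 1 + ln (M + 1) - ln eta + 2].
Proof.
move=> q0 T1 eta01 N0 M0 PhiM ka01 La0.
have T0 : 0 < T by lra.
have ka0 : 0 < ka by case/andP: ka01.
have [Cc C0 hC] := ly_step lyP N0 ka0.
pose eps := (Cc + 1)^-1.
have C1 : 0 < Cc + 1 by lra.
have eps0 : 0 < eps by rewrite invr_gt0.
have Ceps : Cc * eps <= 1 by rewrite ler_pdivrMr//; lra.
pose k2 (i : nat) : R := i.+1%:R^-1.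
have k20 i : 0 < k2 i by rewrite invr_gt0 ltr0n.
pose H (i : nat) (r : R) (n : nat) :=
  Hit B C X Y Om0 Phi ka (k2 i) r N eta eps q (T / n%:R) n.
have /choice[r_ hr] : forall i, exists r, 0 < r /\ exists n1 : nat, forall n, (n1 <= n)%N ->
    (0 < n)%N ->
    (1 + ln (M + 1) - ln (2 * ka)) * fine (P (H i r n)) <= 1 + ln (M + 1) - ln eta + 2.
  move=> i; have [K hK] := hC (k2 i) (k20 i).
  (* Chosen so that the [n] errors [5 * th * (T / n)] add up to [1]; [1 <= T] gives [th <= 1]. *)
  pose th := (5 * T)^-1.
  have th0 : 0 < th by rewrite invr_gt0; lra.
  have th1 : th <= 1 by rewrite invf_le1; lra.
  have th01 : 0 < th <= 1 by rewrite th0.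
  have [r0 r00 hr0] := hK th th01.
  pose K' := Num.max (Num.max K 1) (Num.max Cc (1 + ln (M + 1) - ln ka + Cc * eps)).
  have KK' : K <= K' by rewrite !le_max lexx.
  have K1 : 1 <= K' by rewrite !le_max lexx orbT.
  have CK : Cc <= K' by rewrite !le_max lexx !orbT.
  have LK : 1 + ln (M + 1) - ln ka + Cc * eps <= K' by rewrite !le_max lexx !orbT.
  have K0 : 0 < K' by lra.
  pose r := Num.min r0 (th / (60 * K' ^+ 3)).
  have rp : 0 < r by rewrite lt_min r00 divr_gt0// mulr_gt0// exprn_gt0.
  have rr0 : 0 < r <= r0 by rewrite rp ge_min lexx.
  have rK : 0 < r <= th / (60 * K' ^+ 3) by rewrite rp ge_min lexx orbT.
  have [p [qq [s [m /(step_data_weaken KK') sd]]]] := hr0 r rr0.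
  exists r; split=> //.
  pose hm := th / (48 * (100 * K' ^+ 4)).
  have hm0 : 0 < hm by rewrite divr_gt0// !mulr_gt0// exprn_gt0.
  have [n1 n1T] := exists_nat_gt (T / hm).
  exists n1 => n n1n n0; have n0' : 0 < n%:R :> R by rewrite ltr0n.
  have h0 : 0 < T / n%:R by rewrite divr_gt0.
  have hh : T / n%:R <= hm.
    rewrite ler_pdivrMr// mulrC -ler_pdivrMr// ltW//.
    by apply: (lt_le_trans n1T); rewrite ler_nat.
  have := grid_bound fF rho1 aB aC aX aY mgf FOm0 goodOm0 lyP q0 h0 n ka01 C0 eps0 eta01
    M0 PhiM sd K1 CK LK th01 rK hh La0.
  move=> /le_trans; apply.
  have -> : n%:R * (5 * th * (T / n%:R)) = 1.
    by rewrite /th; field; rewrite !gt_eqF.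
  lra.
(* The shift avoids the degenerate mesh [T / 0]. *)
pose A i n := H i (r_ i) n.+1.
have mA i n : measurable (A i n).
  apply: (Hit_measurable fF aB aC aX aY FOm0 lyP) => //.
  by rewrite divr_gt0// ltr0n.
pose U i := \bigcup_m \bigcap_(n in [set n | (m <= n)%N]) A i n.
have mU i : measurable (U i).
  by apply: bigcup_measurable => m _; exact: bigcap_measurableType.
have UK i : (1 + ln (M + 1) - ln (2 * ka)) * fine (P (U i)) <= 1 + ln (M + 1) - ln eta + 2.
  have [_ [n1 hn1]] := hr i.
  apply: (@liminf_set_bound _ _ _ P (A i) _ _ n1) => // n n1n.
  by apply: hn1 => //; exact: leqW.
exists (\bigcup_m \bigcap_(i in [set i | (m <= i)%N]) U i); split.
- by apply: bigcup_measurable => m _; exact: bigcap_measurableType.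
- move=> w [w0 etaw wN hit].
  have [k0 k00 hk] := eventually_Hit lyP w0 (goodOm0 w0) q0 T0 ka0 eps0 etaw wN hit.
  have [i0 hi0] := exists_nat_gt (k0^-1).
  exists i0 => // i /= ii0.
  have [ri0 _] := hr i.
  have k2i : 0 < k2 i <= k0.
    rewrite k20/= /k2 -[leRHS]invrK lef_pV2 ?posrE ?invr_gt0 ?ltr0n//.
    by rewrite ltW// (lt_le_trans hi0)// ler_nat leqW.
  have [n0 hn0] := hk (k2 i) k2i (r_ i) ri0.
  by exists n0 => // n /= nn0; apply: hn0; exact: leqW.
- exact: (@liminf_set_bound _ _ _ P U _ _ 0%N).
Qed.

Lemma hits_negligible (q T eta N : R) : 0 <= q -> 1 <= T -> 0 < eta <= 1 -> 0 <= N ->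
  P.-negligible (hits q T eta N).
Proof.
move=> q0 T1 eta01 N0.
have [M1 hM1] := ly_bound lyP N.
pose M := Num.max M1 0.
have M0 : 0 <= M by rewrite le_max lexx orbT.
have PhiM x y : 0 <= x <= N -> 0 <= y <= N -> Phi x y <= M.
  by move=> xN yN; rewrite le_max hM1.
have L0 : 0 <= ln (M + 1) by apply: ln_ge0; lra.
(* Then [- ln (2 * ka l) = l]: the covers have probability at most a constant over [l], and their
   intersection is null. *)
pose ka (l : nat) : R := expR (- l%:R) / 2.
have kaE l : ln (2 * ka l) = - l%:R :> R.
  by rewrite /ka mulrC divfK// expRK.
have ka01 l : 0 < ka l <= 1.
  rewrite divr_gt0 ?expR_gt0//= ler_pdivrMr// mul1r.
  have : expR (- l%:R) <= 1 :> R by rewrite expR_le1 oppr_le0.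
  lra.
have La l : 0 <= 1 + ln (M + 1) - ln (2 * ka l).
  by rewrite kaE opprK; have : 0 <= l%:R :> R by []; lra.
have /choice[V hV] := fun l => hits_cover q0 T1 eta01 N0 M0 PhiM (ka01 l) (La l).
exists (\bigcap_l V l); split.
- by apply: bigcap_measurableType => l _; case: (hV l).
- have mV : measurable (\bigcap_l V l).
    by apply: bigcap_measurableType => l _; case: (hV l).
  have x0 : 0 <= fine (P (\bigcap_l V l)) by rewrite fine_ge0.
  suff : fine (P (\bigcap_l V l)) = 0.
    by move=> e; rewrite -(@fineK _ (P (\bigcap_l V l))) ?fin_num_measure// e.
  apply/eqP; rewrite eq_le x0 andbT leNgt; apply/negP => x_gt0.
  set x := fine _ in x0 x_gt0.
  pose K := 1 + ln (M + 1) - ln eta + 2.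
  have [l hl] := exists_nat_gt (K / x).
  have [mVl _ bl] := hV l.
  have : (1 + ln (M + 1) - ln (2 * ka l)) * x <= K.
    apply: le_trans bl; rewrite ler_wpM2l// fine_P_le//.
    by move=> w; apply.
  rewrite kaE opprK leNgt => /negP; apply.
  apply: (@lt_le_trans _ _ (l%:R * x)); first by rewrite -ltr_pdivrMr.
  by rewrite ler_pM2r//; lra.
- by move=> w hw l _; case: (hV l) => _ + _; apply.
Qed.

(** Every path at the origin at a time [t > 0] falls under one of countably many choices of a
    rational start, a positive lower bound for [Phi] there, a window length and a level, encoded by
    [pickle]. *)
Lemma hits_origin_negligible : P.-negligible
  [set w | Om0 w /\ exists t, 0 < t /\ X t w = 0 /\ Y t w = 0].
Proof.
pose D (k : nat) : set Om := if unpickle k is Some (u, l, a, b) then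
  (if (0 : R) <= ratr (u : rat) then
     hits (ratr u) (a : nat).+1%:R (l : nat).+1%:R^-1 (b : nat)%:R else set0) else set0.
have negD k : P.-negligible (D k).
  rewrite /D; case: (unpickle k) => [[[[u l] a] b]|]; last exact: negligible_set0.
  case: ifPn => u0; last exact: negligible_set0.
  apply: hits_negligible => //; first by rewrite ler1n.
  by rewrite invr_gt0 ltr0n/= invf_le1 ?ltr0n// ler1n.
apply: negligibleS (negligible_bigcup negD) => w [w0 [t [t0 [xt yt]]]].
have [I [J ok]] := goodOm0 w0.
have [u /andP[u0 ut] [xu yu]] := po_pos ok t0.
have ph := ly_gt0 lyP xu yu.
have [l hl] := exists_nat_gt (Phi (X (ratr u) w) (Y (ratr u) w))^-1.
have [a ha] := exists_nat_gt (t - ratr u).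
have [M hM] := po_bound ok (ratr u + a.+1%:R).
have [b hb] := exists_nat_gt M.
exists (pickle (u, l, a, b)); first exact: Logic.I.
rewrite /D pickleK (ltW u0); split; first exact: w0.
- rewrite -[leRHS]invrK lef_pV2 ?posrE ?invr_gt0 ?ltr0n//.
  by rewrite ltW// (lt_trans hl)// ltr_nat.
- move=> s /andP[us sT]; have [|h1 h2] := hM s; first by rewrite (le_trans (ltW u0) us).
  by split; apply: le_trans (ltW hb).
- exists t => //; rewrite (ltW ut)/=.
  have : a%:R <= a.+1%:R :> R by rewrite ler_nat.
  lra.
Qed.

End Avoidance.

Theorem mainTheorem5 (d : measure_display) (Omega : measurableType d)
  (R : realType) (P : probability Omega R) (F : R -> set (set Omega))
  (alpha beta gamma delta rho : R) (B C X Y : R -> Omega -> R) :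
  complete_prob_space P -> filtration F -> usual_conditions P F ->
  -1 <= rho <= 1 -> 0 < alpha -> 0 < delta ->
  O2BP P F alpha beta gamma delta rho B C X Y ->
  [\/ (0 <= beta /\ 0 <= gamma /\ -1 <= rho <= alpha + delta),
      (1 / 2 <= alpha /\ 0 <= beta),
      (1 / 2 <= delta /\ 0 <= gamma) |
      exists lambda mu : R, [/\ 0 < lambda, 0 < mu,
        0 <= lambda * alpha + mu * gamma,
        0 <= lambda * beta + mu * delta &
        (Num.sqrt (lambda * (lambda * alpha + mu * gamma))
          + Num.sqrt (mu * (lambda * beta + mu * delta))) ^+ 2
        >= 1 / 2 * (lambda ^+ 2 + mu ^+ 2 + 2 * rho * lambda * mu)]] ->
  P.-negligible [set w | exists t, 0 < t /\ X t w = 0 /\ Y t w = 0].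
Proof.
move=> _ fF [F0 _] /andP[rho1 rho1'] al0 de0 [[aB aC [N1 [mN1 PN1 hN1]] mgf] aX aY
  [N2 [mN2 PN2 hN2]]] cond.
have [Phi lyP] : exists Phi, lyapunov alpha beta gamma delta rho Phi.
  case: cond => [[be0 [ga0 /andP[_ rad]]]|[al2 be0]|[de2 ga0]|[la [mu [la0 mu0 a0 b0 hc]]]].
  - by eexists; exact: lyapunov_quadratic.
  (* With weights [1] and [0] the two drift coefficients are [alpha] and [beta], and the quadratic
     inequality reads [1 / 2 <= alpha]. *)
  - exists (fun x y => 1 * x + 0 * y); apply: lyapunov_linear; [lra..|].
    rewrite [1 * (1 * alpha + _)](_ : _ = alpha); last by ring.
    by rewrite [0 * (_ + _)]mul0r sqrtr0 addr0 sqr_sqrtr ?(ltW al0)//; lra.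
  - exists (fun x y => 0 * x + 1 * y); apply: lyapunov_linear; [lra..|].
    rewrite [1 * (_ + 1 * delta)](_ : _ = delta); last by ring.
    by rewrite [0 * (_ + _)]mul0r sqrtr0 add0r sqr_sqrtr ?(ltW de0)//; lra.
  - exists (fun x y => la * x + mu * y); apply: lyapunov_linear => //; [exact: ltW..|].
    exact: addr_gt0.
(* The exceptional paths are removed at time [0]: the usual conditions put null sets in [F 0], so
   the killed events stay adapted. *)
pose Om0 := ~` (N1 `|` N2).
have mN : measurable (N1 `|` N2) by exact: measurableU.
have PN : P (N1 `|` N2) = 0%E.
  apply/eqP; rewrite eq_le measure_ge0 andbT.
  have [z1 z2] : (P N1 <= 0)%E /\ (P N2 <= 0)%E by rewrite PN1 PN2.
  apply: (le_trans (measureU2 P mN1 mN2)).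
  by rewrite -[leRHS]adde0; apply: leeD.
have FOm0 : F 0 Om0.
  have [sF _] := fF.1 0 (lexx 0).
  by rewrite /Om0 -setTD; case: sF => _ h _; apply: h; exact: F0.
have good w : Om0 w ->
    good_path alpha beta gamma delta (X ^~ w) (Y ^~ w) (B ^~ w) (C ^~ w).
  move=> /not_orP[n1 n2].
  have [_ [_ [cB cC]]] : [set w | B 0 w = 0 /\ C 0 w = 0 /\
      {within [set s : R | 0 <= s], continuous (fun s => B s w)} /\
      {within [set s : R | 0 <= s], continuous (fun s => C s w)}] w.
    by apply: contrapT => h; apply: n1; apply: hN1.
  have := contra_notP (@hN2 w) n2.
  move=> [xy0 cX cY eqs].
  apply: good_path_intro => // t t0; have [? ? [? ?] ? ?] := eqs t t0 => //.
have := hits_origin_negligible fF rho1 aB aC aX aY mgf FOm0 good lyP.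
move=> neg1.
have neg2 : P.-negligible (N1 `|` N2).
  by exists (N1 `|` N2); split; [exact: mN|exact: PN|].
apply: negligibleS (negligibleU neg2 neg1) => w hw.
have [n|n] := pselect ((N1 `|` N2) w); first by left.
by right.
Qed.
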